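(* Let $D=[-1,1]^2$, let $\Omega\subset\mathbb{R}^2$ be an open set with $D\subset\Omega$, let $f:\Omega\to\mathbb{R}$, and let $\omega(x,y)=(1-x^2)^{-1/2}(1-y^2)^{-1/2}$. Suppose that for some integers $k,l\ge 1$: (a) $f_{x^ky^l}$ is of bounded variation in the sense of Vitali on $D$, the quantities $c_{i,j}^{(k+1,l+1)}$ ($i,j\ge 0$) are well defined, and $V_{k,l}:=\int_D|f_{x^{k+1}y^{l+1}}(x,y)|\,\omega(x,y)\,dx\,dy<\infty$; (b) $x\mapsto f_{x^k}(x,y_0)$ is of bounded variation on $[-1,1]$ for each $y_0\in[-1,1]$, and $V_k:=\int_D|f_{x^{k+1}}(x,y)|\,\omega(x,y)\,dx\,dy<\infty$; (c) $y\mapsto f_{y^l}(x_0,y)$ is of bounded variation on $[-1,1]$ for each $x_0\in[-1,1]$, and $V_l:=\int_D|f_{y^{l+1}}(x,y)|\,\omega(x,y)\,dx\,dy<\infty$. Then for all integers $d_x,d_y,n_x,n_y$ with $n_x-1\ge k$, $n_y-1\ge l$, $k\le d_x<n_x$ and $l\le d_y<n_y$, $$\|f-\tilde{\mathsf{C}}_{d_x,d_y}[f]\|_1\le\frac{8V^*}{\pi^2}\left(\frac{4}{kl(d_x-k+1)^k(d_y-l+1)^l}+\frac{2(d_y+1)}{k(d_x-k+1)^k}+\frac{2(d_x+1)}{l(d_y-l+1)^l}\right),$$ where $V^*=\max\{V_{k,l},V_k,V_l\}$ and $\tilde{\mathsf{C}}_{d_x,d_y}[f]$ is the Chebyshev approximant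 of $f$ whose coefficients are computed by the Gauss–Chebyshev quadrature rule with $n_x\times n_y$ nodes.
   Context: $\|g\|_1=\int_D|g(x,y)|\,dx\,dy$. $T_i(x)=\cos(i\arccos x)$ is the Chebyshev polynomial of degree $i$. The notation $f_{x^r y^s}$ means $\partial^{r+s}f/\partial x^r\partial y^s$, and $f_{x^r}=\partial^rf/\partial x^r$, $f_{y^s}=\partial^s f/\partial y^s$. For integers $r,s\ge 0$ and $i,j\ge0$, $$c_{i,j}^{(r,s)}=\frac{4}{\pi^2}\int_0^\pi\!\!\int_0^\pi f_{x^r y^s}(\cos\theta_x,\cos\theta_y)\cos(i\theta_x)\cos(j\theta_y)\,d\theta_x\,d\theta_y ,$$ and $c_{i,j}=c_{i,j}^{(0,0)}$ are the Chebyshev coefficients of $f$ (assumed to exist). The approximate coefficients are $$\tilde c_{i,j}=\frac{4}{n_xn_y}\sum_{l_x=1}^{n_x}\sum_{l_y=1}^{n_y}f(x_{l_x},y_{l_y})T_i(x_{l_x})T_j(y_{l_y}),$$ where $x_1,\dots,x_{n_x}$ and $y_1,\dots,y_{n_y}$ are the roots of $T_{n_x}$ and $T_{n_y}$, respectively, and $$\tilde{\mathsf{C}}_{d_x,d_y}[f](x,y)=\sum_{i=0}^{d_x}{}'\sum_{j=0}^{d_y}{}'\tilde c_{i,j}T_i(x)T_j(y),$$ where a prime on a sum means that its index-zero term is halved (so the coefficients of $T_0(x)T_0(y)$, $T_0(x)T_j(y)$ with $j>0$, $T_i(x)T_0(y)$ with $i>0$ are $\tilde c_{0,0}/4$, $\tilde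 c_{0,j}/2$, $\tilde c_{i,0}/2$). A function $g:D\to\mathbb{R}$ is of bounded variation in the sense of Vitali if $\sup\sum_{p,q}|g(x_{p+1},y_{q+1})-g(x_{p+1},y_q)-g(x_p,y_{q+1})+g(x_p,y_q)|<\infty$, the supremum being over all grids $-1=x_0<\dots<x_P=1$, $-1=y_0<\dots<y_Q=1$. The integrals involving $f_{x^{k+1}y^{l+1}}$ are double Stieltjes integrals with respect to $f_{x^k y^l}$: $f_{x^{k+1}y^{l+1}}\,dx\,dy$ stands for the signed Stieltjes measure $d(f_{x^ky^l})$ on $D$ generated by the rectangular increments of $f_{x^k y^l}$, and $|f_{x^{k+1}y^{l+1}}|\,dx\,dy$ for its variation; thus $V_{k,l}=\int_D\omega\,|d(f_{x^ky^l})|$ and $c_{i,j}^{(k+1,l+1)}=\frac{4}{\pi^2}\int_D T_i(x)T_j(y)\omega(x,y)\,d(f_{x^ky^l})$. Likewise $V_k=\int_{-1}^1\left(\int_{-1}^1(1-x^2)^{-1/2}|d_xf_{x^k}(x,y)|\right)(1-y^2)^{-1/2}dy$, where $|d_xf_{x^k}(x,y)|$ is the variation measure of $x\mapsto f_{x^k}(x,y)$, and $V_l$ is the same with the roles of $x$ and $y$ exchanged. When the derivatives are ordinary integrable densities these are ordinary integrals. *)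

(* Defs.v *)
From HB Require Import structures.
From mathcomp Require Import all_boot all_order all_algebra.
From mathcomp Require Import all_classical all_reals all_analysis.

Set Implicit Arguments.
Unset Strict Implicit.
Unset Printing Implicit Defensive.

Import Order.TTheory GRing.Theory Num.Theory.
Import numFieldNormedType.Exports.

Local Open Scope classical_set_scope.
Local Open Scope ring_scope.

Section Domain.
Context {R : realType}.

Definition square : set (R * R) := `[(-1 : R), 1] `*` `[(-1 : R), 1].

(* The value at [x = 1] or [x = -1] is irrelevant: neither Lebesgue measure nor
   the Stieltjes measures below charge the sides of the square. *)
Definition weight1 (x : R) : R := (Num.sqrt (1 - x ^+ 2))^-1.

Definition weight (p : R * R) : R := weight1 p.1 * weight1 p.2.

Definition clamp (x : R) : R := Num.max (-1) (Num.min x 1).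

End Domain.

Section PartialDerivatives.
Context {R : realType}.

(* [partial r s f] is d^(r+s) f / dx^r dy^s = (d/dx)^r (d/dy)^s f *)
Definition partial (r s : nat) (f : R * R -> R) (p : R * R) : R :=
  derive1n r (fun x => derive1n s (fun y => f (x, y)) p.2) p.1.

(* The [n]-th derivative of [h] at [a] genuinely exists; this is needed because
   [derive1n n h] is a total operator. *)
Fixpoint nderivable (n : nat) (h : R -> R) (a : R) : Prop :=
  if n is m.+1 then
    (\forall t \near a, nderivable m h t) /\ derivable (derive1n m h) a 1
  else True.

Definition partial_exists (r s : nat) (f : R * R -> R) (p : R * R) : Prop :=
  [/\ nderivable s (fun y => f (p.1, y)) p.2,
      (0 < r)%N -> \forall x \near p.1, nderivable s (fun y => f (x, y)) p.2
    & nderivable r (fun x => partial 0 s f (x, p.2)) p.1].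

End PartialDerivatives.

Section Vitali.
Context {R : realType}.

Definition rect_incr (g : R * R -> R) (a b c d : R) : R :=
  g (b, d) - g (b, c) - g (a, d) + g (a, c).

(* The grid is [-1 = x_0 < x_1 < ...] times [-1 = y_0 < y_1 < ...], where
   [s = [:: x_1; ...]] and [t = [:: y_1; ...]]. *)
Definition vitali_sum (g : R * R -> R) (s t : seq R) : R :=
  let X := nth 0 (-1 :: s) in let Y := nth 0 (-1 :: t) in
  \sum_(0 <= p < size s) \sum_(0 <= q < size t)
    `|rect_incr g (X p) (X p.+1) (Y q) (Y q.+1)|.

Definition vitali_bounded_variation (g : R * R -> R) : Prop :=
  has_ubound [set vitali_sum g st.1 st.2 | st in
    [set st : seq R * seq R | itv_partition (-1) 1 st.1 /\
                              itv_partition (-1) 1 st.2]].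

End Vitali.

Section Stieltjes.
Context {R : realType}.
Local Notation mR := (measurableTypeR R).
Local Notation mR2 := (measurableTypeR R * measurableTypeR R)%type.
Local Open Scope ereal_scope.

(* The variation measure of [h] on [-1, 1]: the Lebesgue-Stieltjes extension
   (as in [lebesgue_stieltjes_measure]) generated by
   ]a, b] |-> (total variation of [h] over [a, b]), for [-1 <= a <= b <= 1];
   nothing is charged outside of the segment. *)
Definition variation_measure (h : R -> R) : set mR -> \bar R :=
  mu_ext (wlength (fun x => fine (total_variation (-1)%R (clamp x) h))).

(* [nu] is generated by the rectangular increments of [g] on the square (there
   is at most one such [nu]); clamping extends [g] constantly outside of the square, so that [nu] charges
   nothing there. *)
Definition generated_by_increments (g : R * R -> R)
    (nu : {charge set mR2 -> \bar R}) : Prop :=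
  forall a b c d : R, (a <= b)%R -> (c <= d)%R ->
    nu (`]a, b] `*` `]c, d]) =
    (rect_incr g (clamp a) (clamp b) (clamp c) (clamp d))%:E.

Definition has_stieltjes_measure (g : R * R -> R) : Prop :=
  exists nu, generated_by_increments g nu.

(* The junk value [czero] is only taken when [has_stieltjes_measure g] fails. *)
Definition stieltjes_measure (g : R * R -> R)
    : {charge set mR2 -> \bar R} :=
  if pselect (has_stieltjes_measure g) is left e then sval (cid e) else czero.

Definition charge_abs (nu : {charge set mR2 -> \bar R})
    : set mR2 -> \bar R :=
  charge_variation (svalP (cid (svalP (cid (Hahn_decomposition nu))))).

End Stieltjes.

Section Chebyshev.
Context {R : realType}.
Local Notation mR := (measurableTypeR R).
Local Notation mR2 := (measurableTypeR R * measurableTypeR R)%type.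
Local Notation lambda := (@lebesgue_measure R).

(* Only used on [-1, 1], where [acos] is the usual arccosine. *)
Definition chebT (i : nat) (x : R) : R := cos (i%:R * acos x).

Definition chebT_roots (n : nat) : set R :=
  [set x | x \in `[-1, 1] /\ chebT n x = 0].

Definition cheb_coef_exists (f : R * R -> R) (i j : nat) : Prop :=
  (lambda \x lambda)%E.-integrable (`[0, pi] `*` `[0, pi] : set mR2)
    (fun t => (f (cos t.1, cos t.2) *
               cos (i%:R * t.1) * cos (j%:R * t.2))%:E).

(* The integral of [T_i(x) T_j(y) weight(x, y)] over the square against the
   signed Stieltjes measure of [g] is well defined. *)
Definition stieltjes_cheb_coef_exists (g : R * R -> R) (i j : nat) : Prop :=
  has_stieltjes_measure g /\
  (charge_abs (stieltjes_measure g)).-integrable (square : set mR2)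
    (fun p => (chebT i p.1 * chebT j p.2 * weight p)%:E).

(* The sums run over the finitely many roots of [T_nx] and [T_ny]. *)
Definition approx_coef (nx ny : nat) (f : R * R -> R) (i j : nat) : R :=
  4 / (nx%:R * ny%:R) *
  \sum_(x \in chebT_roots nx) \sum_(y \in chebT_roots ny)
    f (x, y) * chebT i x * chebT j y.

Definition half0 (i : nat) : R := if i == 0%N then 2^-1 else 1.

Definition cheb_approx (nx ny dx dy : nat) (f : R * R -> R) (p : R * R) : R :=
  \sum_(0 <= i < dx.+1) \sum_(0 <= j < dy.+1)
    half0 i * half0 j * approx_coef nx ny f i j * chebT i p.1 * chebT j p.2.

Local Open Scope ereal_scope.

Definition L1norm (g : R * R -> R) : \bar R :=
  \int[lambda \x lambda]_(p in (square : set mR2)) `|g p|%:E.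

Definition Vxy (k l : nat) (f : R * R -> R) : \bar R :=
  \int[charge_abs (stieltjes_measure (partial k l f))]_(p in
    (square : set mR2)) (weight p)%:E.

Definition Vx (k : nat) (f : R * R -> R) : \bar R :=
  \int[lambda]_(y in `[(-1)%R, 1%R])
    ((\int[variation_measure (fun x => partial k 0 f (x, y))]_(x in
       (`[(-1)%R, 1%R] : set mR)) (weight1 x)%:E) * (weight1 y)%:E).

Definition Vy (l : nat) (f : R * R -> R) : \bar R :=
  \int[lambda]_(x in `[(-1)%R, 1%R])
    ((\int[variation_measure (fun y => partial 0 l f (x, y))]_(y in
       (`[(-1)%R, 1%R] : set mR)) (weight1 y)%:E) * (weight1 x)%:E).

End Chebyshev.

(* Main.v *)
(** Let [P_x] be the univariate operator that interpolates at the Chebyshev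
    nodes and truncates after degree [d_x], applied in the variable [x], and
    [P_y] its analogue. The approximant is [P_x P_y f], and
    [I - P_x P_y = (I - P_x) + (I - P_y) - (I - P_x) (I - P_y)], so that no
    double Chebyshev series is needed: everything follows from the univariate
    estimate
      [|| h - P h ||_1 <= 41 / (6 pi) * Var (h^(k)) / (k (d - k + 1)^k)],
    applied once to each of the first two terms and once in each variable to
    the last one.

    For the univariate estimate, [h] is approximated by polynomials [p] whose
    [k]-th derivative is a Bernstein polynomial of [h^(k)], so that the
    variation of [p^(k)] is at most that of [h^(k)] on a finite grid. The
    Chebyshev coefficients of [p^(k)] are [O(1 / i)] by Abel summation, hence
    those of [p] are at most [2 / pi * Var / (i (i - 1) ... (i - k))] by
    [a_i = (a'_(i - 1) - a'_(i + 1)) / (2 i)]; finally [P T_i = T_i] for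
    [i <= d], and [P T_i] is [0] or [+- T_j] otherwise.

    The constant [41 / 12 = 17 / 12 + 2] in place of the obvious [4] as a bound
    for [|| T_i - P T_i ||_1] is what makes the mixed term fit. *)

Require Import Defs.
From HB Require Import structures.
From mathcomp Require Import all_boot all_order all_algebra.
From mathcomp Require Import all_classical all_reals all_analysis.
From mathcomp Require Import measurable_realfun ring lra zify.

Import Order.TTheory GRing.Theory Num.Theory.
Import numFieldNormedType.Exports.

Local Open Scope classical_set_scope.
Local Open Scope ring_scope.

(** * Discrete cosine sums and the interpolation-truncation operator *)

Section ChebyshevNodes.
Set Implicit Arguments.
Unset Strict Implicit.
Context {R : realType}.
Implicit Types (n d i j m : nat) (x t : R).

(** Continuity of the [k]-th derivative is not among the hypotheses, yet approximation by Bernstein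
    polynomials needs it. It is automatic: a function of bounded variation has one-sided limits
    everywhere, and a derivative cannot jump. Uniform approximation is then enough, since [I - P] is
    bounded in the sup norm once [n] and [d] are fixed.

    The univariate estimate is kept in terms of variation on a finite grid because of the mixed
    term. For fixed [x], applying it in [y] to the function [(I - P_x) f] leaves a sum over the
    [y]-grid of [|(I - P_x) u_m (x)|], where [u_m] is the increment of [f_{y^l}] between two
    consecutive grid points. Integrating in [x] and applying the estimate again, now to each [u_m],
    yields rectangular increments of [f_{x^k y^l}], which is what the Stieltjes measure sees. Grid
    sums are dominated by the weighted integrals because the weight is at least 1 inside the square;
    the limit along the [y]-grids is taken by Fatou's lemma. *)

Definition node_angle n m : R := m.*2.+1%:R * (pi / n.*2%:R).

Definition node n m : R := cos (node_angle n m).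

Lemma node_angle_itv n m : (m < n)%N -> 0 <= node_angle n m <= pi.
Proof.
move=> mn; rewrite /node_angle; have n0 : 0 < n.*2%:R :> R by rewrite ltr0n; lia.
rewrite mulr_ge0 ?divr_ge0 ?pi_ge0//=.
rewrite mulrCA -[leRHS]mulr1 ler_wpM2l ?pi_ge0// ler_pdivrMr// mul1r ler_nat.
lia.
Qed.

Lemma chebT_cos i t : 0 <= t <= pi -> chebT i (cos t) = cos (i%:R * t).
Proof. by move=> t0; rewrite /chebT cosK// in_itv. Qed.

Lemma chebT_node i n m : (m < n)%N ->
  chebT i (node n m) = cos (i%:R * node_angle n m).
Proof. by move=> mn; rewrite chebT_cos// node_angle_itv. Qed.

Lemma chebT_norm_le1 i x : `|chebT i x| <= 1.
Proof. exact: cos_max. Qed.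

(** Telescoping, with [a = pi / (2 n)]: [2 sin (s a) cos ((2 m + 1) s a) = sin ((2 m + 2) s a) - sin
    (2 m s a)]. The number [r] of terms is free because Abel summation needs the partial sums, and
    leaving the sine undivided spares a nonvanishing condition. *)
Lemma sum_cos_node_angle n r (s : R) :
  2 * sin (s * (pi / n.*2%:R)) * (\sum_(m < r) cos (s * node_angle n m)) =
  sin (r.*2%:R * s * (pi / n.*2%:R)).
Proof.
elim: r => [|r IH]; first by rewrite big_ord0 mulr0 !mul0r sin0.
rewrite big_ord_recr/= mulrDr IH /node_angle.
set a := pi / _.
have -> : r.+1.*2%:R * s * a = s * (r.*2.+1%:R * a) + s * a.
  by rewrite doubleS -!natr1; ring.
have -> : r.*2%:R * s * a = s * (r.*2.+1%:R * a) - s * a.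
  by rewrite -!natr1; ring.
by rewrite [in RHS]sinD sinB; ring.
Qed.

Lemma sin_natM_pi i : sin (i%:R * pi) = 0 :> R.
Proof.
elim: i => [|i IH]; first by rewrite mul0r sin0.
by rewrite -natr1 mulrDl mul1r sinDpi IH oppr0.
Qed.

Lemma sum_cos_node_angle_eq0 n (s : nat) : (0 < s < n.*2)%N ->
  \sum_(m < n) cos (s%:R * node_angle n m) = 0 :> R.
Proof.
move=> /andP[s0 sn].
have n0 : n.*2%:R != 0 :> R by rewrite pnatr_eq0; lia.
have /eqP := sum_cos_node_angle n n s%:R.
have -> : n.*2%:R * s%:R * (pi / n.*2%:R) = s%:R * pi :> R by field.
rewrite sin_natM_pi mulf_eq0 => /orP[|/eqP//].
rewrite mulf_eq0 pnatr_eq0/= => /eqP h.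
have : 0 < sin (s%:R * (pi / n.*2%:R)) :> R.
  apply: sin_gt0_pi; rewrite mulr_gt0 ?ltr0n// ?divr_gt0 ?pi_gt0 ?ltr0n//=; last lia.
  rewrite mulrCA -[ltRHS]mulr1 ltr_pM2l ?pi_gt0// ltr_pdivrMr ?mul1r ?ltr_nat ?ltr0n//.
  lia.
by rewrite h ltxx.
Qed.

Lemma cosMcos (a b : R) : cos a * cos b = 2^-1 * (cos (a + b) + cos (a - b)).
Proof. by rewrite cosD cosB; field. Qed.

Lemma cos_natB i j t : cos (i%:R * t - j%:R * t) = cos ((maxn i j - minn i j)%:R * t) :> R.
Proof.
case: (leqP i j) => ij.
  by rewrite natrB// -cosN; congr cos; ring.
by rewrite natrB ?(ltnW ij)//; congr cos; ring.
Qed.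

(* [half0] is exactly the inverse of the squared norm of [T_j] for the
   discrete inner product [2 / n * \sum_m]. *)
Lemma discrete_orthogonality n i j : (i <= n)%N -> (j < n)%N ->
  half0 j * (2 / n%:R * \sum_(m < n) cos (i%:R * node_angle n m) *
    cos (j%:R * node_angle n m)) = (i == j)%:R :> R.
Proof.
move=> ni nj; have n0 : n%:R != 0 :> R by rewrite pnatr_eq0; lia.
under eq_bigr do rewrite cosMcos cos_natB -mulrDl -natrD.
rewrite -mulr_sumr big_split/=.
have S0 : \sum_(m < n) cos (0%:R * node_angle n m) = n%:R :> R.
  under eq_bigr do rewrite mul0r cos0.
  by rewrite sumr_const card_ord.
have [ij|ij] := eqVneq i j; first subst j.
  rewrite maxnn minnn subnn S0 /half0; have [->|i0] := eqVneq i 0%N.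
    by rewrite add0n S0 /=; field.
  rewrite sum_cos_node_angle_eq0 ?(negbTE i0) ?add0r /=; [by field|lia].
rewrite !sum_cos_node_angle_eq0 ?addr0 ?mulr0//; lia.
Qed.

(** At a node, [2 n] times the angle is an odd multiple of [pi]. Hence the frequencies [i],
    [2 n - i] and [i - 2 n] give the same values up to sign, and any frequency folds back into
    [[0, n]]. *)
Lemma cos_node_angle_alias n i : (0 < n)%N -> exists e : R, exists2 j,
  (j <= n)%N & `|e| <= 1 /\ forall m, cos (i%:R * node_angle n m) =
    e * cos (j%:R * node_angle n m).
Proof.
move=> n0; have nn : n.*2%:R != 0 :> R by rewrite pnatr_eq0; lia.
have E m : n.*2%:R * node_angle n m = m.*2%:R * pi + pi.
  by rewrite /node_angle mulrCA [n.*2%:R * _]mulrC divfK// -natr1 mulrDl mul1r.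
have C m : cos (n.*2%:R * node_angle n m) = -1 :> R.
  rewrite E cosDpi; congr (- _).
  elim: m {E} => [|m IH]; first by rewrite mul0r cos0.
  by rewrite doubleS -!natr1 !mulrDl mul1r !cosDpi opprK.
have S m : sin (n.*2%:R * node_angle n m) = 0 :> R.
  by rewrite E -[X in _ + X]mul1r -mulrDl natr1 sin_natM_pi.
elim/ltn_ind: i => i IH.
have [ni|ni] := leqP i n.
  by exists 1, i => //; split; [rewrite normr1|move=> m; rewrite mul1r].
have [n2i|n2i] := leqP i n.*2.
  exists (-1), (n.*2 - i)%N; first lia.
  split; first by rewrite normrN1.
  by move=> m; rewrite natrB// mulrBl cosB C S; ring.
have [|e [j jn [e1 ej]]] := IH (i - n.*2)%N; first lia.
exists (- e), j => //; split; first by rewrite normrN.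
move=> m; rewrite mulNr -ej natrB ?mulrBl ?cosB ?C ?S; last lia.
by ring.
Qed.

Definition dcoef n (h : R -> R) j : R :=
  2 / n%:R * \sum_(m < n) h (node n m) * cos (j%:R * node_angle n m).

Definition cheb_proj n d (h : R -> R) x : R :=
  \sum_(j < d.+1) half0 j * dcoef n h j * chebT j x.

(** A crude bound suffices: it is applied to an approximation error that can be made arbitrarily
    small with [d] fixed. *)
Lemma cheb_proj_le_sup n d (h : R -> R) (e : R) : (0 < n)%N ->
  (forall x, -1 <= x <= 1 -> `|h x| <= e) ->
  forall x, `|cheb_proj n d h x| <= d.+1%:R * 2 * e.
Proof.
move=> n0 he x; have nn : n%:R != 0 :> R by rewrite pnatr_eq0; lia.
have e0 : 0 <= e by apply: le_trans (he 0 _) => //; lra.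
rewrite (le_trans (ler_norm_sum _ _ _))//.
have -> : d.+1%:R * 2 * e = \sum_(j < d.+1) 2 * e.
  by rewrite sumr_const card_ord -[RHS]mulr_natl mulrA.
apply: ler_sum => j _; rewrite !normrM -[leRHS]mulr1 ler_pM ?mulr_ge0//; last first.
  exact: chebT_norm_le1.
rewrite -[leRHS]mul1r ler_pM//.
  by rewrite /half0; case: ifP => _; rewrite ?normr1// ger0_norm; lra.
rewrite -normrM ger0_norm ?divr_ge0//.
rewrite -mulrA ler_wpM2l// ler_pdivrMl ?ltr0n//.
rewrite (le_trans (ler_norm_sum _ _ _))//.
have -> : n%:R * e = \sum_(m < n) e by rewrite sumr_const card_ord mulr_natl.
apply: ler_sum => m _.
rewrite normrM -[leRHS]mulr1 ler_pM// ?cos_max// he//.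
by rewrite cos_geN1 cos_le1.
Qed.

Lemma cheb_projE n d (h : R -> R) x : cheb_proj n d h x =
  \sum_(m < n) (\sum_(j < d.+1) half0 j * (2 / n%:R) *
     cos (j%:R * node_angle n m) * chebT j x) * h (node n m).
Proof.
rewrite /cheb_proj /dcoef; under eq_bigr do rewrite mulrA mulr_sumr mulr_suml.
rewrite exchange_big/=; apply: eq_bigr => m _; rewrite mulr_suml.
by apply: eq_bigr => j _; ring.
Qed.

Lemma cheb_projB n d (h g : R -> R) x :
  cheb_proj n d (fun y => h y - g y) x = cheb_proj n d h x - cheb_proj n d g x.
Proof.
by rewrite !cheb_projE -sumrB; apply: eq_bigr => m _; rewrite mulrBr.
Qed.

Lemma cheb_proj_sum n d (I : eqType) (r : seq I) (c : I -> R) (h : I -> R -> R) x :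
  cheb_proj n d (fun y => \sum_(i <- r) c i * h i y) x =
  \sum_(i <- r) c i * cheb_proj n d (h i) x.
Proof.
rewrite !cheb_projE; under [RHS]eq_bigr do rewrite cheb_projE mulr_sumr.
rewrite exchange_big/=; apply: eq_bigr => m _; rewrite mulr_sumr.
by apply: eq_bigr => i _; rewrite mulrCA.
Qed.

Lemma eq_cheb_proj n d (h g : R -> R) : {in `[-1, 1], h =1 g} ->
  cheb_proj n d h =1 cheb_proj n d g.
Proof.
move=> hg x; rewrite !cheb_projE; apply: eq_bigr => m _; rewrite hg//.
by rewrite in_itv/= cos_geN1 cos_le1.
Qed.

(** The operator sees only node values, so [T_i] may be replaced by its alias. The alias may be [n]
    itself, where [T_n] vanishes at all nodes; this is why [discrete_orthogonality] allows its first
    index to equal [n]. *)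
Lemma cheb_proj_alias n d i : (d < n)%N ->
  exists e : R, exists2 j, (j <= n)%N & `|e| <= 1 /\
  forall x, cheb_proj n d (chebT i) x = e * (j <= d)%:R * chebT j x.
Proof.
move=> dn; have [|e [j jn [e1 ij]]] := @cos_node_angle_alias n i; first lia.
exists e, j => //; split=> // x; rewrite /cheb_proj /dcoef.
under eq_bigr => s _.
  under eq_bigr do rewrite chebT_node// ij -mulrA.
  rewrite -mulr_sumr (mulrCA (2 / n%:R)) (mulrCA (half0 s)) discrete_orthogonality//.
  over.
  exact: leq_trans (ltn_ord s) dn.
rewrite -[RHS]mulrA.
have [jd|jd] := leqP j d.
  rewrite (bigD1 (Ordinal (jd : j < d.+1)%N))//= eqxx mulr1 mul1r.
  rewrite big1 ?addr0// => s sj; case: eqP => [js|]; last by rewrite mulr0 mul0r.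
  by move: sj; rewrite -val_eqE/= js eqxx.
rewrite mul0r mulr0 big1// => s _; case: eqP => [js|]; last by rewrite mulr0 mul0r.
by move: (ltn_ord s); rewrite -js ltnS leqNgt jd.
Qed.

Lemma cheb_proj_chebT_le1 n d i x : (d < n)%N -> `|cheb_proj n d (chebT i) x| <= 1.
Proof.
move=> dn; have [e [j _ [e1 ->]]] := cheb_proj_alias i dn.
rewrite !normrM -[leRHS]mulr1 ler_pM ?mulr_ge0// ?chebT_norm_le1//.
rewrite -[leRHS]mulr1 ler_pM//.
by case: (leqP j d); rewrite ?normr1 ?normr0.
Qed.

Lemma cheb_proj_chebT n d i x : (i <= d)%N -> (d < n)%N ->
  cheb_proj n d (chebT i) x = chebT i x.
Proof.
move=> id dn; rewrite /cheb_proj /dcoef.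
under eq_bigr => s _.
  under eq_bigr do rewrite chebT_node//.
  rewrite discrete_orthogonality//; last exact: leq_trans (ltn_ord s) dn.
  over.
  by rewrite ltnW// (leq_ltn_trans id dn).
rewrite (bigD1 (Ordinal (id : i < d.+1)%N))//= eqxx mul1r.
rewrite big1 ?addr0// => s si; case: eqP => [js|]; last by rewrite mul0r.
by move: si; rewrite -val_eqE/= js eqxx.
Qed.

End ChebyshevNodes.

(** * Bernstein polynomials: positivity, variation and approximation *)

Section Bernstein.
Set Implicit Arguments.
Unset Strict Implicit.
Context {R : realType}.
Implicit Types (n : nat) (c w : nat -> R) (x y : R).

(* de Casteljau recursion: the Bernstein polynomial on [-1, 1] with control
   values [c 0, ..., c n] *)
Fixpoint bern n c : {poly R} :=
  if n is m.+1 then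
    (2^-1)%:P * ((1 - 'X) * bern m c + (1 + 'X) * bern m (c \o S))
  else (c 0%N)%:P.

Lemma hornerbernS n c x : (bern n.+1 c).[x] =
  2^-1 * ((1 - x) * (bern n c).[x] + (1 + x) * (bern n (c \o S)).[x]).
Proof. by rewrite /= !hornerE. Qed.

Lemma bern_lin n (a b : R) c w :
  bern n (fun j => a * c j + b * w j) = a *: bern n c + b *: bern n w.
Proof.
elim: n c w => [|n IH] c w /=; first by rewrite polyCD !polyCM !mul_polyC.
rewrite (_ : _ \o S = fun j => a * (c \o S) j + b * (w \o S) j)//.
by rewrite !IH -!mul_polyC; ring.
Qed.

Lemma horner_bern_lin n (a b : R) c w x :
  (bern n (fun j => a * c j + b * w j)).[x] = a * (bern n c).[x] + b * (bern n w).[x].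
Proof. by rewrite bern_lin hornerD !hornerZ. Qed.

Lemma bern_cst n (a : R) : bern n (fun=> a) = a%:P.
Proof.
elim: n => //= n IH; rewrite (_ : _ \o S = fun=> a)// IH.
have -> : (1 - 'X) * a%:P + (1 + 'X) * a%:P = 2%:P * a%:P by rewrite (polyCMn 1 2); ring.
by rewrite mulrA -polyCM mulVf ?pnatr_eq0// mul1r.
Qed.

Lemma bern_ge0 n c x : -1 <= x <= 1 -> (forall j, (j <= n)%N -> 0 <= c j) ->
  0 <= (bern n c).[x].
Proof.
move=> x1; elim: n c => [|n IH] c c0; first by rewrite hornerC c0.
rewrite hornerbernS mulr_ge0 ?invr_ge0// addr_ge0// mulr_ge0 ?IH//; try lra.
- by move=> j jn; rewrite c0// leqW.
- by move=> j jn; rewrite c0.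
Qed.

Lemma bern_le n c w x : -1 <= x <= 1 -> (forall j, (j <= n)%N -> c j <= w j) ->
  (bern n c).[x] <= (bern n w).[x].
Proof.
move=> x1 cw; rewrite -subr_ge0.
have -> : (bern n w).[x] - (bern n c).[x] = (bern n (fun j => 1 * w j + (-1) * c j)).[x].
  by rewrite horner_bern_lin; ring.
by apply: bern_ge0 => // j jn; move: (cw _ jn); lra.
Qed.

(** The de Casteljau step averages two nondecreasing polynomials, and the second dominates the
    first; moving [x] to the right raises both and shifts weight to the larger one. *)
Lemma bern_nondecreasing n c : (forall j, (j < n)%N -> c j <= c j.+1) ->
  forall x y, -1 <= x -> x <= y -> y <= 1 -> (bern n c).[x] <= (bern n c).[y].
Proof.
elim: n c => [|n IH] c cS x y x1 xy y1; first by rewrite !hornerC.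
rewrite !hornerbernS ler_wpM2l ?invr_ge0//.
have H1 : (bern n c).[x] <= (bern n c).[y].
  by apply: IH => // j jn; rewrite cS// ltnW.
have H2 : (bern n (c \o S)).[x] <= (bern n (c \o S)).[y].
  by apply: IH => // j jn; rewrite /= cS.
have H3 : (bern n c).[y] <= (bern n (c \o S)).[y].
  by apply: bern_le => [|j jn]; [lra|rewrite /= cS].
nra.
Qed.

Lemma bern_at1 n c : (bern n c).[1] = c n.
Proof.
elim: n c => [|n IH] c; first by rewrite hornerC.
by rewrite hornerbernS !IH /=; field.
Qed.

Lemma bern_atN1 n c : (bern n c).[-1] = c 0%N.
Proof.
elim: n c => [|n IH] c; first by rewrite hornerC.
by rewrite hornerbernS !IH /=; field.
Qed.

Definition seq_var n c : R := \sum_(j < n) `|c j.+1 - c j|.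

(* [w +- c] is nondecreasing when [w j = seq_var j c]. *)
Lemma bern_variation n c : let W := bern n (fun j => seq_var j c) in
  (W.[1] - W.[-1] = seq_var n c) /\
  forall x y, -1 <= x -> x <= y -> y <= 1 ->
    `|(bern n c).[y] - (bern n c).[x]| <= W.[y] - W.[x].
Proof.
move=> W; split.
  by rewrite bern_at1 bern_atN1 /seq_var big_ord0 subr0.
move=> x y x1 xy y1.
have M (e : R) : `|e| = 1 -> (bern n (fun j => 1 * seq_var j c + e * c j)).[x] <=
    (bern n (fun j => 1 * seq_var j c + e * c j)).[y].
  move=> e1; apply: bern_nondecreasing => // j jn.
  rewrite /seq_var big_ord_recr/=.
  have := ler_norm (- (e * (c j.+1 - c j))); rewrite normrN normrM e1 mul1r.
  lra.
have := M 1 (normr1 _); have := M (-1) (normrN1 _).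
rewrite !horner_bern_lin -/W ler_norml; lra.
Qed.

(** [bern n c] evaluated at [x] is the expectation of [c] under the binomial law with [n] trials and
    success probability [(1 + x) / 2]; this is its mean, and [bern_sq] gives its second moment. *)
Lemma bern_id n x : (bern n (fun j => j%:R)).[x] = n%:R * ((1 + x) / 2).
Proof.
elim: n => [|n IH]; first by rewrite hornerC mul0r.
rewrite hornerbernS (_ : _ \o S = fun j => 1 * j%:R + 1 * 1); last first.
  by apply/funext => j /=; rewrite !mul1r natr1.
by rewrite horner_bern_lin bern_cst hornerC IH -(natr1 n); field.
Qed.

Lemma bern_sq n x : (bern n (fun j => j%:R ^+ 2)).[x] =
  n%:R * (n%:R - 1) * ((1 + x) / 2) ^+ 2 + n%:R * ((1 + x) / 2).
Proof.
elim: n => [|n IH]; first by rewrite hornerC !mul0r addr0 expr0n.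
rewrite hornerbernS (_ : _ \o S = fun j => 1 * (1 * j%:R ^+ 2 + 2 * j%:R) + 1 * 1); last first.
  by apply/funext => j /=; rewrite -(natr1 j); ring.
by rewrite !horner_bern_lin bern_cst hornerC IH bern_id -(natr1 n); field.
Qed.

(* The nodes avoid the endpoints, where [weight1] takes a junk value and the
   Stieltjes measures give no control. *)
Definition bnode n j : R := -1 + 2 * (j.+1%:R / n.+2%:R).

Lemma bnode_itv n j : (j <= n)%N -> -1 < bnode n j < 1.
Proof.
move=> jn; rewrite /bnode.
have : 0 < j.+1%:R / n.+2%:R :> R by rewrite divr_gt0 ?ltr0n.
have : j.+1%:R / n.+2%:R < 1 :> R.
  by rewrite ltr_pdivrMr ?ltr0n// mul1r ltr_nat; lia.
by move: (_ / _) => q; lra.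
Qed.

Lemma bnode_lt n i j : (i < j)%N -> bnode n i < bnode n j.
Proof.
move=> ij; rewrite /bnode ltrD2l ltr_pM2l// ltr_pM2r ?invr_gt0 ?ltr0n//.
by rewrite ltr_nat.
Qed.

(** In the binomial reading, the left side is the variance [n (1 - x^2) / (n + 2)^2] plus the
    squared bias [4 x^2 / (n + 2)^2] caused by keeping the nodes away from the endpoints. *)
Lemma bern_bnode_dist2 n x : -1 <= x <= 1 ->
  (bern n (fun j => (bnode n j - x) ^+ 2)).[x] <= 4 / n.+2%:R.
Proof.
move=> x1; have n0 : n%:R + 2 != 0 :> R by rewrite -natrD pnatr_eq0 addn2.
pose A : R := (2 / n.+2%:R - (1 + x)) ^+ 2.
pose B : R := 4 / n.+2%:R * (2 / n.+2%:R - (1 + x)).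
pose C : R := 4 / n.+2%:R ^+ 2.
have E2 : n.+2%:R = n%:R + 2 :> R by rewrite -addn2 natrD.
have -> : (fun j => (bnode n j - x) ^+ 2) =
    (fun j => 1 * (A * 1 + B * j%:R) + C * j%:R ^+ 2).
  apply/funext => j; rewrite /A /B /C /bnode -(natr1 j) E2; field.
  exact: n0.
rewrite !horner_bern_lin bern_cst hornerC bern_id bern_sq /A /B /C E2.
rewrite [leLHS](_ : _ =
    4 / (n%:R + 2) * ((n%:R * (1 - x ^+ 2) / 4 + x ^+ 2) / (n%:R + 2))); last first.
  by field.
have n2 : 0 < n%:R + 2 :> R by rewrite ltr_wpDl.
rewrite -[leRHS]mulr1 ler_wpM2l ?divr_ge0 ?(ltW n2)// ler_pdivrMr// mul1r.
have : 0 <= n%:R :> R by [].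
have : 0 <= x ^+ 2 <= 1 by rewrite sqr_ge0/=; nra.
nra.
Qed.

(** Bernstein's argument: a positive operator that fixes constants preserves the quadratic majorant
    of [v - v x], and its second moment is [O(1 / n)]. *)
Lemma bern_approx n (v : R -> R) (e K x : R) : -1 <= x <= 1 -> 0 <= K ->
  (forall t, -1 <= t <= 1 -> `|v t - v x| <= e + K * (t - x) ^+ 2) ->
  `|(bern n (v \o bnode n)).[x] - v x| <= e + K * (4 / n.+2%:R).
Proof.
move=> x1 K0 vx.
have E (a : R) : (bern n (fun j => a * v (bnode n j) + (- a) * v x)).[x] =
    a * ((bern n (v \o bnode n)).[x] - v x).
  rewrite (_ : (fun _ => _) = fun j => a * (v \o bnode n) j + (- a) * (fun=> v x) j)//.
  by rewrite horner_bern_lin bern_cst hornerC; ring.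
have F : (bern n (fun j => 1 * e + K * (bnode n j - x) ^+ 2)).[x] <= e + K * (4 / n.+2%:R).
  by rewrite horner_bern_lin bern_cst hornerC mul1r lerD2l ler_wpM2l// bern_bnode_dist2.
have G (a : R) : `|a| = 1 -> a * ((bern n (v \o bnode n)).[x] - v x) <= e + K * (4 / n.+2%:R).
  move=> a1; rewrite -E; apply: le_trans F; apply: bern_le => // j jn.
  have b1 : -1 <= bnode n j <= 1 by have /andP[/ltW -> /ltW ->] := @bnode_itv n j jn.
  rewrite mul1r (le_trans _ (vx _ b1))//.
  rewrite mulNr -mulrBr (le_trans (ler_norm _))// normrM a1 mul1r//.
have := G 1 (normr1 _); have := G (-1) (normrN1 _); rewrite ler_norml.
by rewrite mulN1r mul1r lerNl => -> ->.
Qed.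

End Bernstein.

(** * Chebyshev expansions of polynomials and their antiderivatives *)

Section ChebyshevPolynomials.
Set Implicit Arguments.
Unset Strict Implicit.
Context {R : realType}.
Implicit Types (n m i j N : nat) (a b : nat -> R) (x t : R).

Fixpoint cheb_poly n : {poly R} :=
  match n with
  | 0 => 1
  | 1 => 'X
  | (m.+1 as p).+1 => 2 *: ('X * cheb_poly p) - cheb_poly m
  end.

(** The polynomials [U_n] of the second kind: both [T_n] and the derivative of [T_{n + 1}] are
    simple in this basis, so coefficients are compared there. *)
Fixpoint chebU_poly n : {poly R} :=
  match n with
  | 0 => 1
  | 1 => 2 *: 'X
  | (m.+1 as p).+1 => 2 *: ('X * chebU_poly p) - chebU_poly m
  end.

Lemma pair_ind (P : nat -> Prop) : P 0%N -> P 1%N ->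
  (forall n, P n -> P n.+1 -> P n.+2) -> forall n, P n.
Proof.
move=> P0 P1 PS n; suff [] : P n /\ P n.+1 by [].
by elim: n => // n [Pn PSn]; split => //; exact: PS.
Qed.

Lemma cheb_polySS n : cheb_poly n.+2 = 2 *: ('X * cheb_poly n.+1) - cheb_poly n.
Proof. by []. Qed.

Lemma chebU_polySS n : chebU_poly n.+2 = 2 *: ('X * chebU_poly n.+1) - chebU_poly n.
Proof. by []. Qed.

Lemma cheb_poly_cos n t : (cheb_poly n).[cos t] = cos (n%:R * t).
Proof.
elim/pair_ind: n => [||n IH1 IH2]; first by rewrite /= hornerC mul0r cos0.
  by rewrite /= hornerX mul1r.
rewrite cheb_polySS hornerD hornerN hornerZ hornerM hornerX IH1 IH2.
have -> : n.+2%:R * t = n.+1%:R * t + t by rewrite -[n.+2%:R]natr1; ring.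
have -> : n%:R * t = n.+1%:R * t - t by rewrite -[n.+1%:R]natr1; ring.
by rewrite cosB [in RHS]cosD; ring.
Qed.

Lemma cheb_polyE n x : -1 <= x <= 1 -> (cheb_poly n).[x] = chebT n x.
Proof. by move=> x1; rewrite -[in LHS](acosK (x := x))// cheb_poly_cos. Qed.

Lemma cheb_polyU1 n : cheb_poly n.+1 = chebU_poly n.+1 - 'X * chebU_poly n.
Proof.
elim/pair_ind: n => [||n IH1 IH2].
- by rewrite /= mulr1 -[X in _ - X]scale1r -scalerBl (_ : 2 - 1 = 1 :> R) ?scale1r//; ring.
- by rewrite /= -!mul_polyC; ring.
rewrite cheb_polySS IH1 IH2 (chebU_polySS n.+1) (chebU_polySS n) -!mul_polyC; ring.
Qed.

Lemma cheb_polyU2 n : 2 *: cheb_poly n.+2 = chebU_poly n.+2 - chebU_poly n.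
Proof. by rewrite cheb_polyU1 chebU_polySS -!mul_polyC; ring. Qed.

Lemma deriv_cheb_poly n : (cheb_poly n.+1)^`() = n.+1%:R *: chebU_poly n.
Proof.
elim/pair_ind: n => [||n IH1 IH2].
- by rewrite /= derivX scale1r.
- by rewrite /= derivB derivZ derivM derivX derivC -!mul_polyC; ring.
rewrite cheb_polySS derivB derivZ derivM IH1 IH2 derivX mul1r scalerDr.
rewrite cheb_polyU2 chebU_polySS -!mul_polyC -(natr1 n.+2) -(natr1 n.+1).
by rewrite !polyCD; ring.
Qed.

Lemma size_coef_cheb_poly n : (size (cheb_poly n) <= n.+1)%N /\ (cheb_poly n)`_n != 0.
Proof.
elim/pair_ind: n => [||n [s1 c1] [s2 c2]].
- by rewrite /= size_poly1 coef1 oner_eq0.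
- by rewrite /= size_polyX coefX oner_eq0.
have n2 : (cheb_poly n)`_n.+2 = 0 by rewrite nth_default// ltnW// ltnS.
split; last by rewrite cheb_polySS coefB n2 coefZ coefXM/= subr0 mulf_neq0// pnatr_eq0.
apply/leq_sizeP => j nj; rewrite cheb_polySS coefB coefZ coefXM.
rewrite [(cheb_poly n)`_j]nth_default; last by rewrite (leq_trans s1)// ltnW// ltnW.
rewrite nth_default ?mulr0 ?subr0 ?if_same ?mulr0//.
by rewrite (leq_trans s2)//; case: j nj.
Qed.

Definition cheb_sum N a : {poly R} := \sum_(i < N) (half0 i * a i) *: cheb_poly i.

(** The zero tail of [a] lets the recurrence between the coefficients of a polynomial and those of
    its antiderivative hold at every index, without boundary cases. *)
Lemma cheb_expansion N (p : {poly R}) : (size p <= N)%N ->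
  exists2 a, p = cheb_sum N a & forall i, (N <= i)%N -> a i = 0.
Proof.
elim: N p => [|N IH] p.
  rewrite leqn0 size_poly_eq0 => /eqP ->; exists (fun=> 0) => //.
  by rewrite /cheb_sum big_ord0.
move=> pN; have [sN cN] := size_coef_cheb_poly N.
pose r := p`_N / (cheb_poly N)`_N.
have [|a ea a0] := IH (p - r *: cheb_poly N).
  apply/leq_sizeP => j; rewrite leq_eqVlt coefB coefZ => /orP[/eqP <-|Nj].
    by rewrite /r divfK// subrr.
  by rewrite !nth_default ?mulr0 ?subr0// (leq_trans _ Nj).
exists (fun i => if (i < N)%N then a i else if i == N then r / half0 N else 0).
  rewrite /cheb_sum big_ord_recr/= ltnn eqxx mulrCA mulfV ?mulr1; last first.
    by rewrite /half0; case: ifP => _; rewrite ?oner_eq0// invr_eq0 pnatr_eq0.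
  apply/eqP; rewrite -subr_eq ea /cheb_sum; apply/eqP/eq_bigr => i _.
  by rewrite ltn_ord.
by move=> i Ni; rewrite ltnNge ltnW//= gtn_eqF.
Qed.

Lemma cheb_sumU N a : cheb_sum N.+2 a = 2^-1 *: (\sum_(i < N.+2) a i *: chebU_poly i
  - \sum_(i < N) a i.+2 *: chebU_poly i).
Proof.
elim: N => [|N IH].
  rewrite /cheb_sum !big_ord_recr !big_ord0/= !add0r subr0 /half0/= mul1r.
  by rewrite scalerDr !scalerA; congr (_ + _ *: _); field.
rewrite /cheb_sum big_ord_recr -/(cheb_sum N.+2 a) IH.
rewrite [in RHS]big_ord_recr/= [X in _ = _ *: (_ - X)]big_ord_recr/=.
have -> : (half0 N.+2 * a N.+2) *: cheb_poly N.+2 =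
    2^-1 *: (a N.+2 *: (chebU_poly N.+2 - chebU_poly N)).
  rewrite -cheb_polyU2 /half0/= mul1r !scalerA; congr (_ *: _).
  by field.
by rewrite -scalerDr scalerBr; congr (_ *: _); rewrite opprD addrACA.
Qed.

Lemma deriv_cheb_sum N b : (cheb_sum N.+1 b)^`() =
  \sum_(i < N) (b i.+1 * i.+1%:R) *: chebU_poly i.
Proof.
rewrite /cheb_sum raddf_sum big_ord_recl/= derivZ derivC scaler0 add0r.
apply: eq_bigr => i _; rewrite derivZ deriv_cheb_poly scalerA.
by rewrite /half0/= mul1r.
Qed.

(** Compare coefficients of [U_i]: the derivative of [T_{i + 1}] is [(i + 1) U_i], while
    [2 T_{i + 2} = U_{i + 2} - U_i]. *)
Lemma cheb_sum_antideriv N a (y : R) : (forall i, (N <= i)%N -> a i = 0) ->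
  exists b, [/\ (cheb_sum N.+1 b)^`() = cheb_sum N a,
    (cheb_sum N.+1 b).[-1] = y,
    forall i, (N < i)%N -> b i = 0 &
    forall i, b i.+1 = (a i - a i.+2) / (2 * i.+1%:R)].
Proof.
move=> a0.
pose b0 i := if i is j.+1 then (a j - a j.+2) / (2 * j.+1%:R) else 0.
(* The constant term is free and is used to prescribe the value at [-1]; the factor 2 cancels
   [half0 0]. *)
pose b i := if i is j.+1 then b0 i else 2 * (y - (cheb_sum N.+1 b0).[-1]).
exists b; split=> //.
- rewrite deriv_cheb_sum.
  have -> : cheb_sum N a = cheb_sum N.+2 a.
    by rewrite /cheb_sum !big_ord_recr/= !a0// !mulr0 !scale0r !addr0.
  rewrite cheb_sumU !big_ord_recr/= !a0// !scale0r !addr0 -sumrB scaler_sumr.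
  apply: eq_bigr => i _; rewrite -scalerBl scalerA; congr (_ *: _).
  have : i.+1%:R != 0 :> R by rewrite pnatr_eq0.
  by move: (i.+1%:R) => d d0; field.
- rewrite /cheb_sum big_ord_recl/= hornerD -[RHS](subrK (cheb_sum N.+1 b0).[-1]).
  congr (_ + _).
    by rewrite /half0/= mulKf ?pnatr_eq0// hornerZ hornerC mulr1.
  by rewrite /cheb_sum big_ord_recl/= mulr0 scale0r add0r.
- by case=> // i Ni /=; rewrite !a0 ?subr0 ?mul0r//; lia.
Qed.

End ChebyshevPolynomials.

(** * Decay of Chebyshev coefficients *)

Section ChebyshevCoefficients.
Set Implicit Arguments.
Unset Strict Implicit.
Context {R : realType}.
Implicit Types (n m i j k d N : nat) (a b : nat -> R) (x t M : R).

Lemma abel_summation n (q c : nat -> R) :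
  \sum_(m < n.+1) q m * c m = q n * (\sum_(m < n.+1) c m) -
    \sum_(m < n) (\sum_(s < m.+1) c s) * (q m.+1 - q m).
Proof.
elim: n => [|n IH]; first by rewrite !big_ord_recr !big_ord0/=; ring.
rewrite big_ord_recr IH /= [in RHS]big_ord_recr/= [X in _ = _ - X]big_ord_recr/=.
by ring.
Qed.

(** Only the first-order behaviour at 0 matters: the lemma is used at [t = i pi / (2 n)] with [n]
    tending to infinity. *)
Lemma sin_ge (t : R) : 0 <= t -> t * (1 - t) <= sin t.
Proof.
move=> t0.
have [|c ct] := @MVT_segment R sin cos 0 t t0 (fun x _ => is_derive_sin x).
  by apply: continuous_subspaceT; exact: continuous_sin.
rewrite sin0 !subr0 => ->.
have [c0 ct'] : 0 <= c /\ c <= t by move: ct; rewrite in_itv/= => /andP.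
have [|s sc] := @MVT_segment R cos (fun x => - sin x) 0 c c0 (fun x _ => is_derive_cos x).
  by apply: continuous_subspaceT; exact: continuous_cos.
rewrite cos0 subr0 => E; rewrite [leRHS]mulrC ler_wpM2l//.
have := sin_le1 s; nra.
Qed.

Lemma le_of_div (x y z : R) n0 : (forall n, (n0 <= n)%N -> x <= y + z / n%:R) -> x <= y.
Proof.
move=> H; rewrite leNgt; apply/negP => yx.
have d0 : 0 < x - y by rewrite subr_gt0.
pose n := maxn n0.+1 (Num.bound `|z / (x - y)|).
have n0' : 0 < n%:R :> R by rewrite ltr0n; rewrite /n; lia.
have /H : (n0 <= n)%N by rewrite /n; lia.
have : z / (x - y) < n%:R.
  rewrite (le_lt_trans (ler_norm _))// (lt_le_trans (archi_boundP _))//.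
  by rewrite ler_nat leq_maxr.
rewrite ltr_pdivrMr// => h; rewrite -lerBlDl ler_pdivlMr//; lra.
Qed.

Lemma dcoef_cheb_sum n N a i : (N <= n)%N -> (i < n)%N ->
  half0 i * dcoef n (horner (cheb_sum N a)) i = half0 i * (if (i < N)%N then a i else 0).
Proof.
move=> Nn ni; rewrite /dcoef.
under eq_bigr => m _.
  rewrite /cheb_sum horner_sum mulr_suml.
  under eq_bigr do rewrite hornerZ -mulrA [(cheb_poly _).[_]]cheb_poly_cos.
  over.
rewrite exchange_big/= !mulr_sumr.
under eq_bigr => j _.
  rewrite -mulr_sumr (mulrCA (2 / _)) (mulrCA (half0 i)) discrete_orthogonality//; last first.
    by rewrite (leq_trans _ Nn)// ltnW.
  over.
case: ltnP => [iN|Ni].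
  rewrite (bigD1 (Ordinal iN))//= eqxx mulr1 big1 ?addr0// => j ji.
  by case: eqP => [ij|]; rewrite ?mulr0//; move: ji; rewrite -val_eqE/= ij eqxx.
rewrite mulr0 big1// => j _; case: eqP => [ij|]; rewrite ?mulr0//.
by move: (ltn_ord j); rewrite ij ltnNge Ni.
Qed.

(* Abel summation against the cosine sums at the [n] nodes, followed by
   [n --> oo], in place of an integration by parts *)
Lemma cheb_coef_bound N a (W : R -> R) i :
  (forall x y, -1 <= x -> x <= y -> y <= 1 ->
    `|(cheb_sum N a).[y] - (cheb_sum N a).[x]| <= W y - W x) ->
  (0 < i)%N -> (i < N)%N -> `|a i| <= 2 / pi * (W 1 - W (-1)) / i%:R.
Proof.
move=> QW i0 iN; set Q := cheb_sum N a in QW.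
have p0 : 0 < pi :> R := pi_gt0 R.
have i0' : 0 < i%:R :> R by rewrite ltr0n.
suff H : `|a i| * (i%:R * (pi / 2)) <= W 1 - W (-1).
  rewrite ler_pdivlMr// mulrAC ler_pdivlMr//; move: H; lra.
(* [z / n] is the loss when [sin t] is replaced by [t (1 - t)] at [t = i pi / (2 n)]. *)
pose z := `|a i| * (i%:R * (pi / 2)) * (i%:R * (pi / 2)).
apply: (@le_of_div _ _ z N.+1) => n Nn.
have n0 : 0 < n%:R :> R by rewrite ltr0n; lia.
pose al : R := pi / n.*2%:R.
have n2E : n.*2%:R = 2 * n%:R :> R by rewrite -mul2n natrM.
have alE : i%:R * al = i%:R * (pi / 2) / n%:R.
  by rewrite /al n2E; field; rewrite gt_eqF.
have al0 : 0 < i%:R * al by rewrite alE !(mulr_gt0, divr_gt0, invr_gt0).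
have sin0 : 0 < sin (i%:R * al).
  apply: sin_gt0_pi; rewrite al0/= alE ltr_pdivrMr// mulrA ltr_pdivrMr// mulrC -mulrA ltr_pM2l//.
  by rewrite -natrM ltr_nat; lia.
have Csum r : 2 * sin (i%:R * al) * `|\sum_(m < r) cos (i%:R * node_angle n m)| <= 1.
  rewrite -[X in X * _]ger0_norm ?mulr_ge0 ?(ltW sin0)//.
  by rewrite -normrM sum_cos_node_angle sin_max.
have W0 x y : -1 <= x -> x <= y -> y <= 1 -> W x <= W y.
  by move=> x1 xy y1; rewrite -subr_ge0 (le_trans _ (QW _ _ x1 xy y1)).
have E : a i = dcoef n (horner Q) i.
  have := @dcoef_cheb_sum n N a i; rewrite iN => /(_ _ _)/mulfI <-//; try lia.
  by rewrite /half0 gtn_eqF ?oner_eq0.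
have : 2 * sin (i%:R * al) * `|\sum_(m < n) Q.[node n m] * cos (i%:R * node_angle n m)| <=
    W 1 - W (-1).
  case: n Nn n0 n2E @al alE al0 sin0 Csum E => // n Nn n0 n2E al alE al0 sin0 Csum E.
  rewrite (abel_summation _ (fun m => Q.[node n.+1 m]) (fun m => cos (i%:R * node_angle n.+1 m))).
  (* The boundary term of the Abel summation vanishes because the cosine sum over all nodes does;
     the remaining partial sums are bounded by [Csum]. *)
  rewrite sum_cos_node_angle_eq0; last lia.
  rewrite mulr0 sub0r normrN.
  apply: (@le_trans _ _ (\sum_(m < n) (W (node n.+1 m) - W (node n.+1 m.+1)))).
    rewrite (le_trans (ler_wpM2l _ (ler_norm_sum _ _ _)))//.
      by rewrite mulr_ge0// ltW.
    rewrite mulr_sumr; apply: ler_sum => m _; rewrite normrM mulrA.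
    rewrite -[leRHS]mul1r ler_pM ?mulr_ge0 ?(ltW sin0)// distrC QW ?cos_geN1 ?cos_le1//.
    have mn := ltn_ord m.
    rewrite /node ltW// ltr_cos ?in_itv/= ?node_angle_itv ?ltnS ?(ltnW mn)//.
    rewrite /node_angle ltr_pM2r ?ltr_nat; first lia.
    by rewrite divr_gt0// ltr0n.
  rewrite (eq_bigr (fun m : 'I_n => - (W (node n.+1 m.+1) - W (node n.+1 m)))); last first.
    by move=> m _; rewrite opprB.
  rewrite sumrN -(big_mkord xpredT (fun m => W (node n.+1 m.+1) - W (node n.+1 m))).
  rewrite telescope_sumr// opprB.
  have B m : -1 <= @node R n.+1 m <= 1 by rewrite /node cos_geN1 cos_le1.
  by rewrite lerB// W0//; case/andP: (B 0%N); case/andP: (B n).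
have aE : `|a i| * n%:R = 2 * `|\sum_(m < n) Q.[node n m] * cos (i%:R * node_angle n m)|.
  rewrite E /dcoef normrM [X in X * _ * _]ger0_norm ?divr_ge0//.
  by field; rewrite gt_eqF.
rewrite mulrAC -aE => H.
have S : i%:R * al * (1 - i%:R * al) <= sin (i%:R * al) by apply: sin_ge; rewrite ltW.
rewrite -lerBlDr; apply: le_trans H.
have -> : `|a i| * (i%:R * (pi / 2)) - z / n%:R = `|a i| * n%:R * (i%:R * al * (1 - i%:R * al)).
  by rewrite alE /z; field; rewrite gt_eqF.
by rewrite ler_wpM2l// mulr_ge0// ltW.
Qed.

(** [p] lists successive antiderivatives with prescribed values at [-1]. The bound [M] does not
    grow: the two terms of [a_i - a_{i + 2}] cost a factor 2, which the denominator [2 (i + 1)]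
    gives back, and the [i + 1] extends the falling factorial. *)
Lemma cheb_chain N a (y : nat -> R) M : 0 <= M -> (forall i, (N <= i)%N -> a i = 0) ->
  (forall i, (0 < i)%N -> `|a i| <= M / i%:R) ->
  forall m, exists p : nat -> {poly R}, exists b,
  [/\ p 0%N = cheb_sum N a,
    forall j, (j < m)%N -> (p j.+1)^`() = p j /\ (p j.+1).[-1] = y j,
    p m = cheb_sum (N + m) b,
    forall i, (N + m <= i)%N -> b i = 0 &
    forall i, (m < i)%N -> `|b i| <= M / (i ^_ m.+1)%:R].
Proof.
move=> M0 a0 aM; elim=> [|m [p [b [p0 pS pm b0 bM]]]].
  exists (fun=> cheb_sum N a), a; rewrite addn0; split => // i i0.
  by rewrite ffactn1 aM.
have [c [c1 c2 c3 c4]] := cheb_sum_antideriv (y m) b0.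
exists (fun j => if j == m.+1 then cheb_sum (N + m).+1 c else p j), c.
rewrite addnS; split => //.
- move=> j; rewrite ltnS => jm; rewrite eqSS (ltn_eqF (jm : (j < m.+1)%N))//.
  by case: eqP => [->|/eqP jm']; [rewrite c1 -pm|apply: pS; rewrite ltn_neqAle jm'].
- by rewrite eqxx.
- case=> // i mi; rewrite c4 normrM normfV [`|2 * _|]ger0_norm//.
  have i0 : 0 < 2 * i.+1%:R :> R by rewrite mulr_gt0.
  have f0 : 0 < (i ^_ m.+1)%:R :> R by rewrite ltr0n ffact_gt0.
  have f2 : (i ^_ m.+1)%:R <= (i.+2 ^_ m.+1)%:R :> R.
    by rewrite ler_nat; elim: (m.+1) => // s IH; rewrite !ffactnSr leq_mul//; lia.
  have h1 : `|b i| <= M / (i ^_ m.+1)%:R by apply: bM.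
  have h2 : `|b i.+2| <= M / (i ^_ m.+1)%:R.
    apply: le_trans (bM _ _) _; first lia.
    by rewrite ler_wpM2l// lef_pV2 ?posrE// (lt_le_trans f0).
  rewrite ffactSS natrM ler_pdivrMr// (le_trans (ler_normB _ _))//.
  apply: le_trans (lerD h1 h2) _.
  rewrite le_eqVlt; apply/orP; left; apply/eqP.
  field; rewrite gt_eqF//= gt_eqF//.
Qed.

(** Telescoping: [1 / (s + 1)^_(k + 1)] is [1 / k] times [1 / s^_k - 1 / (s + 1)^_k]. What remains
    is [1 / (k d^_k)], and every factor of [d^_k] is at least [d - k + 1]. *)
Lemma sum_inv_ffact k d N : (0 < k)%N -> (k <= d)%N ->
  \sum_(i < N | (d < i)%N) ((i ^_ k.+1)%:R)^-1 <= (k%:R * (d - k + 1)%:R ^+ k)^-1 :> R.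
Proof.
move=> k0 kd.
have k0' : 0 < k%:R :> R by rewrite ltr0n.
have f0 s : (d <= s)%N -> 0 < (s ^_ k)%:R :> R.
  by move=> ds; rewrite ltr0n ffact_gt0 (leq_trans kd).
have E s : (d <= s)%N -> ((s.+1 ^_ k.+1)%:R)^-1 =
    k%:R^-1 * ((s ^_ k)%:R^-1 - (s.+1 ^_ k)%:R^-1) :> R.
  move=> ds; have e1 : (s.+1 ^_ k.+1)%:R = s.+1%:R * (s ^_ k)%:R :> R by rewrite ffactSS natrM.
  have e2 : (s.+1 ^_ k)%:R * (s.+1 - k)%:R = s.+1%:R * (s ^_ k)%:R :> R.
    by rewrite -e1 ffactnSr natrM.
  have := f0 s ds; have := f0 s.+1 (leqW ds).
  rewrite natrB in e2; last by rewrite leqW// (leq_trans kd).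
  move: e1 e2; move: (s.+1 ^_ k)%:R (s ^_ k)%:R (s.+1 ^_ k.+1)%:R => u v w -> e2 u0 v0.
  have sp : 0 < s.+1%:R :> R by [].
  apply/eqP; rewrite -subr_eq0; apply/eqP.
  have -> : (s.+1%:R * v)^-1 - k%:R^-1 * (v^-1 - u^-1) =
     (k%:R * u - s.+1%:R * (u - v)) / (s.+1%:R * v * k%:R * u).
    by field; rewrite !gt_eqF.
  have -> : k%:R * u - s.+1%:R * (u - v) = s.+1%:R * v - u * (s.+1%:R - k%:R) by ring.
  by rewrite e2 subrr mul0r.
have T r : \sum_(i < (d + r).+1 | (d < i)%N) ((i ^_ k.+1)%:R)^-1 =
    k%:R^-1 * ((d ^_ k)%:R^-1 - ((d + r) ^_ k)%:R^-1) :> R.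
  elim: r => [|r IH].
    by rewrite addn0 subrr mulr0 big1// => i; rewrite ltnNge -ltnS ltn_ord.
  rewrite addnS big_mkcond big_ord_recr -big_mkcond/= IH ltnS leq_addr E ?leq_addr//.
  by ring.
have B : (k%:R * (d ^_ k)%:R)^-1 <= (k%:R * (d - k + 1)%:R ^+ k)^-1 :> R.
  have e0 : 0 < (d - k + 1)%:R ^+ k :> R by rewrite exprn_gt0// ltr0n addn1.
  rewrite lef_pV2 ?posrE ?mulr_gt0 ?f0//.
  rewrite ler_wpM2l ?(ltW k0')// -natrX ler_nat.
  suff H s : (s <= k)%N -> ((d - k + 1) ^ s <= d ^_ s)%N by exact: H.
  elim: s => // s IH sk; rewrite ffactnSr expnSr leq_mul ?IH//; lia.
apply: le_trans B.
apply: (@le_trans _ _ (\sum_(i < (d + N).+1 | (d < i)%N) ((i ^_ k.+1)%:R)^-1)).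
  rewrite (big_ord_widen_cond (d + N).+1 (fun i => d < i)%N
    (fun i => (i ^_ k.+1)%:R^-1 : R)); last lia.
  rewrite big_mkcond [leRHS]big_mkcond; apply: ler_sum => i _.
  by case: ltnP => //= _; case: ifP.
by rewrite T invfM ler_wpM2l ?invr_ge0 ?(ltW k0')// gerBl invr_ge0 ltW// f0// leq_addr.
Qed.

End ChebyshevCoefficients.

(** * Monotonicity of the integral without measurability *)

Section LowerIntegral.
Set Implicit Arguments.
Unset Strict Implicit.
Context d (T : measurableType d) {R : realType}.

(* The integral of a nonnegative function is a lower integral, hence
   monotone without any measurability hypothesis. *)
Lemma ge0_le_lower_integral (mu : {measure set T -> \bar R}) (D : set T) (f g : T -> \bar R) :
  (forall x, D x -> 0 <= f x)%E -> (forall x, D x -> f x <= g x)%E ->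
  (\int[mu]_(x in D) f x <= \int[mu]_(x in D) g x)%E.
Proof.
move=> f0 fg; rewrite !ge0_integralE//; last first.
  by move=> x Dx; rewrite (le_trans (f0 _ Dx))// fg.
apply: ge_ereal_sup => _ [h hf <-]; apply: ereal_sup_ubound; exists h => // x.
apply: le_trans (hf x) _; rewrite /patch; case: ifPn => // xD.
by apply: fg; rewrite inE in xD.
Qed.

End LowerIntegral.

(** * Derivatives with controlled oscillation are continuous *)

Section ContinuityOfDerivatives.
Set Implicit Arguments.
Unset Strict Implicit.
Context {R : realType}.
Implicit Types (u v w : R -> R) (x y t a b e : R).

Definition cont11 v := forall x e, -1 <= x <= 1 -> 0 < e ->
  exists2 d, 0 < d & forall t, -1 <= t <= 1 -> `|t - x| < d -> `|v t - v x| < e.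

Lemma cont11_within v : cont11 v -> {within `[-1, 1], continuous v}.
Proof.
move=> cv; apply/subspace_continuousP => x; rewrite /= in_itv/= => x1.
apply/cvgrPdist_lt => e e0; have [d d0 H] := cv x e x1 e0.
rewrite near_withinE; apply/nbhs_ballP; exists d => //= t tx.
by rewrite in_itv/= => t1; rewrite distrC; apply: H => //; rewrite distrC.
Qed.

Lemma within_cont11 v : {within `[-1, 1], continuous v} -> cont11 v.
Proof.
move=> /subspace_continuousP cv x e x1 e0.
have /cvgrPdist_lt/(_ e e0) : v @ within `[(-1), 1] (nbhs x) --> v x.
  by apply: cv; rewrite /= in_itv.
rewrite near_withinE => /nbhs_ballP[d /= d0 H]; exists d => // t t1 td.
by rewrite distrC; apply: H; rewrite ?in_itv//= /ball/= distrC.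
Qed.

(* Heine-Cantor; the quadratic term absorbs the pairs of distant points. *)
Lemma cont11_quadratic v e : cont11 v -> 0 < e -> exists2 K, 0 <= K &
  forall x t, -1 <= x <= 1 -> -1 <= t <= 1 -> `|v t - v x| <= e + K * (t - x) ^+ 2.
Proof.
move=> cv e0.
have [d d0 U] : exists2 d, 0 < d & forall x t, -1 <= x <= 1 -> -1 <= t <= 1 ->
    `|t - x| < d -> `|v t - v x| <= e.
  (* Compactness in near-covering form, with the filter [0^'+] of radii, merges the local radii into
     one that serves every [x]. *)
  have /compact_near_coveringP/near_covering_withinP C := @segment_compact R (-1) 1.
  have := C _ 0^'+ (fun d x => forall t, -1 <= t <= 1 -> `|t - x| < d -> `|v t - v x| <= e) _.
  case => [x|r /= r0 H].
    rewrite /= in_itv/= => x1; have e20 : 0 < e / 2 by rewrite divr_gt0.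
    have [r r0 H] := cv x (e / 2) x1 e20.
    exists (ball x (r / 2), [set s | 0 < s < r / 2]) => /=.
      split; first by apply: nbhsx_ballx; rewrite divr_gt0.
      near=> s => /=; apply/andP; split; near: s; first exact: nbhs_right_gt.
      by apply: nbhs_right_lt; rewrite divr_gt0.
    move=> [y s] /= [xy /andP[s0 sr]]; rewrite in_itv/= => y1 t t1 ts.
    rewrite /ball/= in xy.
    have vy : `|v y - v x| < e / 2 by apply: H => //; rewrite distrC; lra.
    have vt : `|v t - v x| < e / 2.
      by apply: H => //; rewrite (le_lt_trans (ler_distD y _ _))// (distrC y x); lra.
    by rewrite (le_trans (ler_distD (v x) _ _))// (distrC (v x)); lra.
  exists (r / 2); first by rewrite divr_gt0.
  move=> x t x1 t1 tx; apply: (H (r / 2) _ _ x) => //=.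
  - by rewrite sub0r normrN gtr0_norm ?divr_gt0//; lra.
  - by rewrite divr_gt0.
have le11 : -1 <= 1 :> R by lra.
have [p _ pM] := EVT_max le11 (cont11_within cv).
have [q _ qM] := EVT_min le11 (cont11_within cv).
have D x t : -1 <= x <= 1 -> -1 <= t <= 1 -> `|v t - v x| <= v p - v q.
  move=> x1 t1; have := (pM x, pM t, qM x, qM t); rewrite !in_itv/= => -[[[H1 H2] H3] H4].
  by rewrite ler_norml; move: (H1 x1) (H2 t1) (H3 x1) (H4 t1); lra.
have D0 : 0 <= v p - v q by apply: le_trans (D 0 0 _ _); rewrite ?normr_ge0//; lra.
exists ((v p - v q) / d ^+ 2) => [|x t x1 t1].
  by rewrite divr_ge0// sqr_ge0.
have [td|td] := ltP `|t - x| d.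
  by rewrite (le_trans (U x t x1 t1 td))// lerDl mulr_ge0 ?sqr_ge0// divr_ge0 ?sqr_ge0.
rewrite (le_trans (D x t x1 t1))// (@le_trans _ _ ((v p - v q) / d ^+ 2 * (t - x) ^+ 2))//.
  rewrite -mulrA ler_peMr// ler_pdivlMl ?exprn_gt0// mulr1 -[leRHS]real_normK ?num_real//.
  by rewrite lerXn2r// nnegrE ltW.
by rewrite lerDr ltW.
Unshelve. all: by end_near. Qed.

(* Darboux: [v] takes values close to [v a] arbitrarily close to [a], by the
   mean value theorem; the control [w] of its oscillation then does the rest. *)
Lemma derivative_right_continuous u v w a b e : a < b ->
  (forall x, a <= x <= b -> is_derive x 1 u (v x)) ->
  (forall x y, a <= x -> x <= y -> y <= b -> `|v y - v x| <= w y - w x) ->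
  0 < e -> exists2 d, 0 < d & forall s, a <= s < a + d -> s <= b -> `|v s - v a| < e.
Proof.
move=> ab uv vw e0.
have wle x y : a <= x -> x <= y -> y <= b -> w x <= w y.
  by move=> ax xy yb; rewrite -subr_ge0 (le_trans _ (vw _ _ ax xy yb)).
(* The infimum of [W] is the right limit of [w] at [a]; the point [a] is excluded because [w] may
   jump there. On []a, c[] the oscillation of [w], hence of [v], is below [e / 2]. *)
pose W := [set w s | s in `]a, b]].
have W0 : has_inf W.
  split; first by exists (w b), b => //=; rewrite in_itv/= ab lexx.
  exists (w a) => _ [s /= + <-]; rewrite in_itv/= => /andP[as_ sb].
  exact: wle (ltW as_) sb.
have e2 : 0 < e / 2 by rewrite divr_gt0.
have [_ [c /= + <-] wc] := inf_adherent e2 W0.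
rewrite in_itv/= => /andP[ac cb].
have osc s t : a < s < c -> a < t < c -> `|v s - v t| < e / 2.
  wlog st : s t / t <= s.
    move=> H sc tc; have [st|/ltW st] := leP t s; first exact: H.
    by rewrite distrC H.
  move=> /andP[as_ sc] /andP[at_ tc].
  have Ws : inf W <= w t.
    by apply: inf_lbound; [case: W0|exists t => //=; rewrite in_itv/= at_ (le_trans (ltW tc))].
  have := vw _ _ (ltW at_) st (le_trans (ltW sc) cb).
  have := wle _ _ (ltW as_) (ltW sc) cb; lra.
have : derivable u a 1 /\ 'D_1 u a = v a.
  by have := uv a; rewrite lexx ltW// => /(_ isT) [].
move=> [Du uva].
have /cvgrPdist_lt/(_ _ e2) : h^-1 *: (u (h *: 1 + a) - u a) @[h --> 0^'] --> v a.
  by rewrite -uva.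
move=> /nbhs_ballP[r /= r0 Hr].
exists (c - a); first lra.
move=> s; rewrite addrC subrK => /andP[]; rewrite le_eqVlt => /orP[/eqP <- _ _|as_ sc _].
  by rewrite subrr normr0.
pose h := Num.min (r / 2) ((s - a) / 2).
have h0 : 0 < h by rewrite lt_min; apply/andP; split; rewrite divr_gt0// subr_gt0.
have hr : h < r by rewrite gt_min; apply/orP; left; lra.
have hs : h < s - a by rewrite gt_min; apply/orP; right; lra.
have := Hr h; rewrite /ball/= sub0r normrN gtr0_norm// => /(_ hr (lt0r_neq0 h0)).
have aha : a < h + a by lra.
have [||x] := @MVT R u v a (h + a) aha.
- by move=> x; rewrite in_itv/= => xa; apply: uv; lra.
- apply: derivable_within_continuous => x; rewrite in_itv/= => xa.
  by have [] : is_derive x 1 u (v x) by apply: uv; lra.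
rewrite in_itv/= => xa; rewrite [h *: 1]mulr1 => ->.
rewrite addrK [_ *: _]mulrC mulfK ?gt_eqF// distrC => vx.
have := osc s x; rewrite as_ sc => /(_ isT).
have -> : a < x < c by lra.
move=> /(_ isT) H; rewrite (le_lt_trans (ler_distD (v x) _ _))//; lra.
Qed.

Lemma derivative_left_continuous u v w a b e : a < b ->
  (forall x, a <= x <= b -> is_derive x 1 u (v x)) ->
  (forall x y, a <= x -> x <= y -> y <= b -> `|v y - v x| <= w y - w x) ->
  0 < e -> exists2 d, 0 < d & forall s, b - d < s <= b -> a <= s -> `|v s - v b| < e.
Proof.
move=> ab uv vw e0.
have [|||d d0 H] := @derivative_right_continuous (fun x => - u (- x)) (fun x => v (- x))
  (fun x => - w (- x)) (- b) (- a) e _ _ _ e0; first lra.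
- move=> x xab; have xab' : a <= - x <= b by lra.
  have := uv _ xab' => ux.
  rewrite -[v _]opprK; apply: is_deriveN.
  have Nx : is_derive x 1 (fun y : R => - y) (-1) by apply: is_deriveN.
  by have := @is_derive1_comp R u (fun y => - y) x (v (- x)) (-1) ux Nx; rewrite mulrN1.
- move=> x y xb xy ya; rewrite distrC; have := vw (- y) (- x); lra.
exists d => // s sb as_; have := H (- s); rewrite !opprK; apply; lra.
Qed.

Lemma derivative_cont11 u v w :
  (forall x, -1 <= x <= 1 -> is_derive x 1 u (v x)) ->
  (forall x y, -1 <= x -> x <= y -> y <= 1 -> `|v y - v x| <= w y - w x) ->
  cont11 v.
Proof.
move=> uv vw x e /andP[x1 x2] e0.
have [dr dr0 Hr] : exists2 d, 0 < d & forall s, x <= s < x + d -> s <= 1 -> `|v s - v x| < e.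
  move: x2; rewrite le_eqVlt => /orP[/eqP ->|x2].
    exists 1 => // s; have [->|] := eqVneq s 1; first by rewrite subrr normr0.
    by rewrite neq_lt; lra.
  apply: (@derivative_right_continuous u v w) => // [y xy|y z xy yz z1].
    by apply: uv; lra.
  by apply: vw => //; lra.
have [dl dl0 Hl] : exists2 d, 0 < d & forall s, x - d < s <= x -> -1 <= s -> `|v s - v x| < e.
  move: x1; rewrite le_eqVlt => /orP[/eqP <-|x1].
    exists 1 => // s; have [->|] := eqVneq s (-1); first by rewrite subrr normr0.
    by rewrite neq_lt; lra.
  apply: (@derivative_left_continuous u v w) => // [y xy|y z xy yz z1].
    by apply: uv; lra.
  by apply: vw => //; lra.
exists (Num.min dl dr); first by rewrite lt_min dl0.
move=> t /andP[t1 t2]; rewrite lt_min => /andP[].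
rewrite ![`|t - x| < _]ltr_norml => tl tr.
by have [tx|/ltW xt] := leP t x; [apply: Hl|apply: Hr] => //; lra.
Qed.

End ContinuityOfDerivatives.

(** * The univariate error estimate *)

Section UnivariateError.
Set Implicit Arguments.
Unset Strict Implicit.
Context {R : realType}.
Implicit Types (n m i j k d N : nat) (a b : nat -> R) (x t M e : R).

(** Absolute values are majorized below by derivatives of polynomials, so that bounding an integral
    amounts to evaluating at the endpoints. *)
Lemma integral_deriv_poly (G : {poly R}) :
  (\int[lebesgue_measure]_(x in `[(-1)%R, 1%R]) (G^`().[x])%:E = (G.[1] - G.[-1])%:E)%E.
Proof.
rewrite (@continuous_FTC2 _ (horner G^`()) (horner G)).
- by rewrite EFinB.
- by lra.
- by apply: continuous_subspaceT; exact: continuous_horner.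
- split; first by move=> x _; exact: derivable_horner.
  + by apply: cvg_at_right_filter; exact: continuous_horner.
  + by apply: cvg_at_left_filter; exact: continuous_horner.
- by move=> x _; rewrite derivE.
Qed.

(* [|c| <= 3/8 + 2/3 * c^2] and the integral of [T_i^2] is at most [1]. *)
Lemma chebT_L1_bound i : (0 < i)%N -> exists2 G : {poly R},
  forall x, -1 <= x <= 1 -> `|chebT i x| <= G^`().[x] &
  G.[1] - G.[-1] <= 17 / 12.
Proof.
case: i => // i _; pose s := i.*2.
pose A : {poly R} := s.+3%:R^-1 *: cheb_poly s.+3 - s.+1%:R^-1 *: cheb_poly s.+1.
have s3 : s.+3%:R != 0 :> R by rewrite pnatr_eq0.
have s1 : s.+1%:R != 0 :> R by rewrite pnatr_eq0.
have dA : A^`() = 2 *: cheb_poly s.+2.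
  rewrite /A derivB !derivZ !deriv_cheb_poly !scalerA !mulVf// !scale1r.
  by rewrite cheb_polyU2.
have T1 n : (cheb_poly n).[1] = 1 :> R by rewrite -cos0 cheb_poly_cos mulr0 cos0.
have TN1 n : (cheb_poly n).[-1] = (-1) ^+ n :> R.
  elim/pair_ind: n => [||n IH1 IH2]; first by rewrite hornerC.
    by rewrite hornerX expr1.
  by rewrite cheb_polySS hornerD hornerN hornerZ hornerM hornerX IH1 IH2 !exprS; ring.
(* With [j = i + 1], the double-angle formula gives [3/8 + 2/3 T_j^2 = 17/24 + T_{2 j} / 3], and [A]
   is an antiderivative of [2 T_{2 j}]. Its odd-degree terms contribute a nonpositive amount between
   the endpoints. *)
exists ((17 / 24) *: 'X + 6^-1 *: A).
  move=> x x1; rewrite derivD !derivZ derivX dA hornerD !hornerZ hornerC cheb_polyE//.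
  have -> : chebT s.+2 x = 2 * chebT i.+1 x ^+ 2 - 1.
    rewrite /chebT; set t := acos x.
    have -> : s.+2%:R * t = (i.+1%:R * t) *+ 2.
      by rewrite /s -doubleS -mul2n natrM -[RHS]mulr_natl mulrA.
    by rewrite cos_mulr2n -[_ *+ 2]mulr_natl.
  set c := chebT _ _; have : 0 <= (`|c| - 3 / 4) ^+ 2 by rewrite sqr_ge0.
  by rewrite sqrrB real_normK ?num_real//; lra.
have AE z : (17 / 24 *: 'X + 6^-1 *: A).[z] = 17 / 24 * z +
    6^-1 * (s.+3%:R^-1 * (cheb_poly s.+3).[z] - s.+1%:R^-1 * (cheb_poly s.+1).[z]).
  rewrite /A; move: (cheb_poly _) (cheb_poly _) => p q.
  by rewrite hornerD !hornerZ hornerX hornerD hornerN !hornerZ.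
rewrite !AE !T1 !TN1 !exprS -signr_odd odd_double expr0.
have : s.+3%:R^-1 <= s.+1%:R^-1 :> R by rewrite lef_pV2 ?posrE// ler_nat; lia.
by move: (s.+3%:R^-1) (s.+1%:R^-1) => u w; lra.
Qed.

Lemma cheb_proj_poly_error k d n N a M : (0 < k)%N -> (k <= d < n)%N -> 0 <= M ->
  (forall i, (k < i)%N -> `|a i| <= M / (i ^_ k.+1)%:R) ->
  exists2 G : {poly R}, forall x, -1 <= x <= 1 ->
    `|(cheb_sum N a).[x] - cheb_proj n d (horner (cheb_sum N a)) x| <= G^`().[x] &
  G.[1] - G.[-1] <= 41 / 12 * M / (k%:R * (d - k + 1)%:R ^+ k).
Proof.
move=> k0 /andP[kd dn] M0 aM.
have [g gP] : exists g : nat -> {poly R}, forall i, (0 < i)%N ->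
    (forall x, -1 <= x <= 1 -> `|chebT i x| <= (g i)^`().[x]) /\
    (g i).[1] - (g i).[-1] <= 17 / 12.
  have : forall i, exists G : {poly R}, (0 < i)%N ->
    (forall x, -1 <= x <= 1 -> `|chebT i x| <= G^`().[x]) /\ G.[1] - G.[-1] <= 17 / 12.
    case=> [|i]; first by exists 0.
    by have [G G1 G2] := @chebT_L1_bound i.+1 isT; exists G.
  by move=> /choice[g gP]; exists g.
(* The summand ['X] has derivative 1, which bounds the projection of [T_i]; its increment 2 is added
   to [17 / 12]. *)
exists (\sum_(i < N | (d < i)%N) `|a i| *: (g i + 'X)) => [x x1|].
  have -> : (cheb_sum N a).[x] = \sum_(i < N) (half0 i * a i) * chebT i x.
    by rewrite horner_sum; apply: eq_bigr => i _; rewrite hornerZ cheb_polyE.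
  rewrite (@eq_cheb_proj _ n d _ (fun y => \sum_(i < N) (half0 i * a i) * chebT i y)); last first.
    move=> y; rewrite in_itv/= => y1.
    by rewrite horner_sum; apply: eq_bigr => i _; rewrite hornerZ cheb_polyE.
  rewrite cheb_proj_sum -sumrB raddf_sum horner_sum (le_trans (ler_norm_sum _ _ _))//.
  rewrite [leRHS]big_mkcond ler_sum// => i _; case: ltnP => [di|id]; last first.
    by rewrite cheb_proj_chebT// subrr normr0.
  have i0 : (0 < i)%N by lia.
  rewrite /= -mulrBr normrM derivZ derivD derivX hornerZ hornerD hornerC ler_pM//.
    by rewrite /half0 gtn_eqF// mul1r.
  rewrite (le_trans (ler_normB _ _))// lerD ?cheb_proj_chebT_le1//.
  by case: (gP _ i0) => ->.
rewrite !horner_sum -sumrB.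
apply: (@le_trans _ _ (\sum_(i < N | (d < i)%N) 41 / 12 * M * (i ^_ k.+1)%:R^-1)).
  apply: ler_sum => i di; have i0 : (0 < i)%N by lia.
  rewrite !hornerZ !hornerD !hornerX -mulrBr.
  have [_ gi] := gP _ i0.
  apply: (@le_trans _ _ (`|a i| * (41 / 12))); first by rewrite ler_wpM2l//; lra.
  have /aM : (k < i)%N by lia.
  move=> H; rewrite (_ : _ * M * _ = M / (i ^_ k.+1)%:R * (41 / 12)); last by ring.
  by rewrite ler_wpM2r.
rewrite -mulr_sumr ler_wpM2l ?sum_inv_ffact//.
by rewrite mulr_ge0.
Qed.

Lemma nderivable_le k j (h : R -> R) x : (j <= k)%N -> nderivable k h x -> nderivable j h x.
Proof.
elim: k j => [|k IH] j; first by rewrite leqn0 => /eqP ->.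
rewrite leq_eqVlt => /orP[/eqP ->//|jk] [/nbhs_singleton hk _].
exact: IH.
Qed.

Lemma nderivable_is_derive k j (h : R -> R) x : (j < k)%N -> nderivable k h x ->
  is_derive x 1 (derive1n j h) (derive1n j.+1 h x).
Proof.
move=> jk /(nderivable_le jk)[_ hj].
by rewrite derive1nS derive1E; apply: DeriveDef.
Qed.

Lemma bounded_derivative (u v : R -> R) e :
  (forall x, -1 <= x <= 1 -> is_derive x 1 u (v x)) ->
  (forall x, -1 <= x <= 1 -> `|v x| <= e) -> u (-1) = 0 ->
  forall x, -1 <= x <= 1 -> `|u x| <= 2 * e.
Proof.
move=> uv ve u0 x x1.
have e0 : 0 <= e by apply: le_trans (ve x x1).
have [|||c cx] := @MVT_segment R u v (-1) x.
- by lra.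
- by move=> y; rewrite in_itv/= => yx; apply: uv; lra.
- apply: derivable_within_continuous => y; rewrite in_itv/= => yx.
  by have [] : is_derive y 1 u (v y) by apply: uv; lra.
rewrite u0 subr0 => ->; rewrite normrM mulrC ler_pM//.
  by rewrite ger0_norm; lra.
by apply: ve; move: cx; rewrite in_itv/=; lra.
Qed.

(** The numerator is [41 / 12] times the factor [2 / pi] of the coefficient bound. *)
Definition cheb_const k d : R := 41 / (6 * pi) / (k%:R * (d - k + 1)%:R ^+ k).

(** The bound holds for every large [N] rather than for one suitable [N], so that a common grid can
    serve several functions at once. *)
Lemma cheb_proj_error k d n (h : R -> R) : (0 < k)%N -> (k <= d < n)%N ->
  (forall x, -1 <= x <= 1 -> nderivable k h x) -> cont11 (derive1n k h) ->
  forall e, 0 < e -> exists N0, forall N, (N0 <= N)%N ->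
  (\int[lebesgue_measure]_(x in `[(-1)%R, 1%R]) `|h x - cheb_proj n d h x|%:E <=
   (cheb_const k d * seq_var N (derive1n k h \o bnode N) + e)%:E)%E.
Proof.
move=> k0 kdn dh ch e e0; set v := derive1n k h.
have n0 : (0 < n)%N by lia.
(* The factors of [C]: [2 ^+ k] from [k] integrations over the segment, 2 from the two parts of the
   Bernstein error, the norm bound of [I - P], and the length of the segment. *)
pose C : R := 2 ^+ k * 2 * (1 + d.+1%:R * 2) * 2.
have C0 : 0 < C by rewrite !mulr_gt0// ?exprn_gt0// addr_gt0.
have e'0 : 0 < e / C by rewrite divr_gt0.
set e' := e / C in e'0.
have [K K0 vK] := cont11_quadratic ch e'0.
exists (Num.bound (K * 4 / e')) => N NK.
have N2 : K * (4 / N.+2%:R) <= e'.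
  rewrite mulrA ler_pdivrMr// [leRHS]mulrC -ler_pdivrMr// ltW//.
  have B : 0 <= K * 4 / e' by apply: divr_ge0; [exact: mulr_ge0|exact: ltW].
  by rewrite (lt_le_trans (archi_boundP B))// ler_nat (leq_trans NK)// leqW.
pose Q := bern N (v \o bnode N).
have Qv x : -1 <= x <= 1 -> `|Q.[x] - v x| <= 2 * e'.
  move=> x1.
  apply: le_trans (@bern_approx R N v e' K x x1 K0 (fun t => vK x t x1)) _.
  by rewrite (_ : 2 * e' = e' + e') ?lerD2l//; ring.
have [a Qa a0] := @cheb_expansion R (size Q) Q (leqnn _).
set N' := size Q in Qa a0.
have [W1 W2] := bern_variation N (v \o bnode N).
set W := bern N (fun j => _) in W1 W2.
set S := seq_var N (v \o bnode N) in W1 *.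
pose M := 2 / pi * S.
have S0 : 0 <= S by apply: sumr_ge0.
have M0 : 0 <= M by rewrite mulr_ge0// divr_ge0// pi_ge0.
have aM i : (0 < i)%N -> `|a i| <= M / i%:R.
  move=> i0; have [iN|Ni] := ltnP i N'; last by rewrite a0// normr0 divr_ge0.
  rewrite /M -W1; apply: cheb_coef_bound iN => //.
  by rewrite -Qa.
(* With these values at [-1], the difference between each antiderivative and the matching derivative
   of [h] starts from 0, so each integration at most doubles the error. *)
pose y j := derive1n (k - j.+1) h (-1).
have [p [b [p0 pS pk b0 bM]]] := cheb_chain y M0 a0 aM k.
have pv j : (j <= k)%N -> forall x, -1 <= x <= 1 ->
    `|derive1n (k - j) h x - (p j).[x]| <= 2 ^+ j * (2 * e').
  elim: j => [|j IH] jk x x1.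
    by rewrite subn0 p0 -Qa mul1r distrC Qv.
  have [dp py] := pS j jk.
  rewrite exprS -mulrA.
  apply: (@bounded_derivative (fun x => derive1n (k - j.+1) h x - (p j.+1).[x])
    (fun x => derive1n (k - j) h x - (p j).[x])) => //; last 2 first.
  - by move=> z z1; apply: IH => //; exact: ltnW.
  - by rewrite py subrr.
  move=> z z1; rewrite -dp; apply: is_deriveB.
  have jk' : (k - j.+1 < k)%N by rewrite ltn_subrL.
  by have := nderivable_is_derive jk' (dh z z1); rewrite subnSK.
have hp x : -1 <= x <= 1 -> `|h x - (p k).[x]| <= 2 ^+ k * (2 * e').
  by move=> x1; have := pv k (leqnn _) x x1; rewrite subnn.
have [G G1 G2] := @cheb_proj_poly_error k d n (N' + k)%N b M k0 kdn M0 bM.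
rewrite -pk in G1.
pose c := (1 + d.+1%:R * 2) * (2 ^+ k * (2 * e')).
have H x : -1 <= x <= 1 -> `|h x - cheb_proj n d h x| <= (G + c *: 'X)^`().[x].
  move=> x1; rewrite derivD derivZ derivX hornerD hornerZ hornerC mulr1.
  have -> : h x - cheb_proj n d h x = ((p k).[x] - cheb_proj n d (horner (p k)) x) +
     ((h x - (p k).[x]) - cheb_proj n d (fun x => h x - (p k).[x]) x).
    by rewrite cheb_projB; ring.
  rewrite (le_trans (ler_normD _ _))// lerD ?G1// (le_trans (ler_normB _ _))//.
  by rewrite /c mulrDl mul1r lerD ?hp// cheb_proj_le_sup.
apply: (@le_trans _ _ (\int[lebesgue_measure]_(x in `[(-1)%R, 1%R]) ((G + c *: 'X)^`().[x])%:E)%E).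
  by apply: ge0_le_lower_integral => x; rewrite /= in_itv/= => x1; rewrite lee_fin// H.
rewrite integral_deriv_poly lee_fin !hornerD !hornerZ !hornerX.
have -> : G.[1] + c * 1 - (G.[-1] + c * -1) = (G.[1] - G.[-1]) + e.
  have eC : e = C * e' by rewrite /e' mulrC divfK// gt_eqF.
  by rewrite [in RHS]eC /c /C; ring.
rewrite lerD2r (le_trans G2)// /M /cheb_const le_eqVlt; apply/orP; left; apply/eqP.
have kd0 : k%:R * (d - k + 1)%:R ^+ k != 0 :> R.
  by rewrite mulf_neq0 ?expf_neq0// pnatr_eq0 ?addn1// -lt0n.
move: (k%:R * _) kd0 => D D0; have := pi_gt0 R; move: pi => q q0.
by field; rewrite D0 (gt_eqF q0).
Qed.

End UnivariateError.

(** * Grid variation against the one-dimensional variation measure *)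

Section VariationMeasures.
Set Implicit Arguments.
Unset Strict Implicit.
Context {R : realType}.
Implicit Types (v h : R -> R) (x y t a b e : R).

(* From [tan (pi / 8) >= pi / 8] and the equation [t^2 + 2 t = 1] satisfied by
   [t = tan (pi / 8)]. *)
Lemma pi_le : pi <= 18 / 5 :> R.
Proof.
have pi0 := pi_gt0 R; have pi4 := pihalf_lt2 R.
pose x : R := pi / 8.
have x0 : 0 < x by rewrite divr_gt0.
have tx : x <= tan x.
  have dt y : 0 <= y <= x -> is_derive y 1 tan ((cos y)^-2).
    move=> yx; apply: is_derive_tan; rewrite gt_eqF// cos_gt0_pihalf//.
    by move: yx; rewrite /x; lra.
  have [||c cx] := @MVT_segment R tan (fun y => (cos y)^-2) 0 x (ltW x0).
  - by move=> y; rewrite in_itv/= => yx; apply: dt; lra.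
  - apply: derivable_within_continuous => y; rewrite in_itv/= => yx.
    by have [] := dt y yx.
  rewrite tan0 !subr0 => ->; rewrite ler_peMl ?(ltW x0)// invf_ge1.
    by rewrite exprn_ile1 ?cos_le1// cos_ge0_pihalf//; move: cx; rewrite in_itv/= /x; lra.
  by rewrite exprn_gt0// cos_gt0_pihalf//; move: cx; rewrite in_itv/= /x; lra.
have cx0 : cos x != 0 by rewrite gt_eqF// cos_gt0_pihalf// /x; lra.
have := tan_piquarter R; rewrite (_ : pi / 4 = x *+ 2); last by rewrite /x -mulr_natl; field.
rewrite tan_mulr2n// -mulr_natl => E.
have d0 : 1 - tan x ^+ 2 != 0.
  by apply/eqP => d0; move: E; rewrite d0 invr0 mulr0 => /esym/eqP; rewrite oner_eq0.
have {}E : 2 * tan x = 1 - tan x ^+ 2 by rewrite -[LHS](divfK d0) E mul1r.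
move: tx E; rewrite /x; nra.
Qed.

Lemma weight1_ge0 x : 0 <= weight1 x.
Proof. by rewrite invr_ge0 sqrtr_ge0. Qed.

Lemma weight1_ge1 x : -1 < x < 1 -> 1 <= weight1 x.
Proof.
move=> x1; have h : 0 < 1 - x ^+ 2 by nra.
rewrite invf_ge1 ?sqrtr_gt0// -[leRHS]sqrtr1 ler_sqrt//.
by rewrite gerBl sqr_ge0.
Qed.

Lemma clampE x : clamp x = if x <= -1 then -1 else if x <= 1 then x else 1.
Proof.
rewrite /clamp; case: (leP x 1) => x1.
  by case: (leP x (-1)).
have -> : x <= -1 = false by apply/negbTE; rewrite -ltNge; lra.
by apply/max_idPr; lra.
Qed.

Lemma clamp_itv x : -1 <= clamp x <= 1.
Proof. by rewrite clampE; case: (leP x (-1)) => ?; case: (leP x 1) => ?; lra. Qed.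

Lemma clamp_id x : -1 <= x <= 1 -> clamp x = x.
Proof. by rewrite clampE; case: (leP x (-1)) => ?; case: (leP x 1) => ?; lra. Qed.

Lemma clamp_le x y : x <= y -> clamp x <= clamp y.
Proof.
rewrite !clampE; case: (leP x (-1)) => ?; case: (leP x 1) => ?;
  by case: (leP y (-1)) => ?; case: (leP y 1) => ?; lra.
Qed.

Lemma clamp_dist x y : `|clamp x - clamp y| <= `|x - y|.
Proof.
wlog xy : x y / x <= y.
  move=> H; have [xy|/ltW xy] := leP x y; first exact: H.
  by rewrite distrC (distrC x) H.
rewrite distrC (distrC x) !ger0_norm ?subr_ge0 ?clamp_le//.
by rewrite !clampE; case: (leP x (-1)) => ?; case: (leP x 1) => ?;
  case: (leP y (-1)) => ?; case: (leP y 1) => ?; lra.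
Qed.

Lemma bounded_variation_control v : bounded_variation (-1) 1 v ->
  let w x := fine (total_variation (-1) x v) in
  forall x y, -1 <= x -> x <= y -> y <= 1 -> `|v y - v x| <= w y - w x.
Proof.
move=> bv w x y x1 xy y1.
have fx : total_variation (-1) x v \is a fin_num.
  by apply/bounded_variationP => //; apply: bounded_variationl bv => //; lra.
have fy : total_variation (-1) y v \is a fin_num.
  by apply/bounded_variationP; [lra|apply: bounded_variationl bv => //; lra].
rewrite -lee_fin EFinB !fineK// lee_suber_addl//.
by rewrite (total_variationD v x1 xy) leeD2l// total_variation_ge.
Qed.

Lemma seq_var_le v w N : (forall x y, -1 <= x -> x <= y -> y <= 1 -> `|v y - v x| <= w y - w x) ->
  seq_var N (v \o bnode N) <= w (bnode N N) - w (bnode N 0).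
Proof.
move=> vw; rewrite -(telescope_sumr (fun j => w (bnode N j)) (leq0n N)) big_mkord.
apply: ler_sum => j _; have jN := ltn_ord j.
have /andP[b1 _] := @bnode_itv R N j (ltnW jN).
have /andP[_ b2] := @bnode_itv R N j.+1 jN.
by apply: vw; rewrite ltW// bnode_lt.
Qed.

(** Continuity of [v] makes its variation function continuous, so [variation_measure v] is a
    Lebesgue-Stieltjes measure whose mass on []-1, bnode N N]] is known. The last node is below 1,
    hence the weight is at least 1 on that interval. *)
Lemma seq_var_le_variation_measure v N : cont11 v -> bounded_variation (-1) 1 v ->
  ((seq_var N (v \o bnode N))%:E <=
   \int[variation_measure v]_(x in `[(-1)%R, 1%R] : set (measurableTypeR R)) (weight1 x)%:E)%E.
Proof.
move=> cv bv; set w := fun x => fine (total_variation (-1) x v).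
have vw := bounded_variation_control bv; rewrite -/w in vw.
have wle x y : -1 <= x -> x <= y -> y <= 1 -> w x <= w y.
  by move=> x1 xy y1; rewrite -subr_ge0 (le_trans _ (vw _ _ x1 xy y1)).
have cw : cont11 w.
  by apply: within_cont11; apply: total_variation_continuous (cont11_within cv) bv; lra.
pose F x := w (clamp x).
have Fnd : {homo F : x y / x <= y}.
  move=> x y xy; have /andP[cx _] := clamp_itv x; have /andP[_ cy] := clamp_itv y.
  by apply: wle => //; exact: clamp_le.
have Frc : right_continuous F.
  move=> x; apply: cvg_at_right_filter; apply/cvgrPdist_lt => e e0.
  have [d d0 H] := cw _ _ (clamp_itv x) e0.
  apply/nbhs_ballP; exists d => //= t xt; rewrite distrC; apply: H; first exact: clamp_itv.
  by rewrite (le_lt_trans (clamp_dist _ _))// distrC.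
pose G : cumulative R R := HB.pack F (isCumulative.Build R _ R F Fnd Frc).
rewrite (_ : variation_measure v = lebesgue_stieltjes_measure G)//.
set mu := lebesgue_stieltjes_measure G.
have N1 := @bnode_itv R N N (leqnn N).
apply: (@le_trans _ _ (\int[mu]_(x in `[(-1)%R, 1%R] : set (measurableTypeR R))
    (\1_(`](-1)%R, bnode N N]) x)%:E)%E); last first.
  apply: ge0_le_lower_integral => x _; rewrite lee_fin ?ler0n// indicE.
  case: (boolP (x \in _)) => [|_]; last exact: weight1_ge0.
  by rewrite inE/= in_itv/= => x1; apply: weight1_ge1; lra.
rewrite integral_indic//= setIidl; last first.
  by move=> x /=; rewrite !in_itv/=; lra.
rewrite /mu /lebesgue_stieltjes_measure /measure_extension measurable_mu_extE /=; last first.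
  exact: is_ocitv.
rewrite wlength_itv_bnd; last lra.
have b0 : -1 <= bnode N 0 :> R by have /andP[/ltW] := @bnode_itv R N 0 (leq0n N).
rewrite lee_fin (le_trans (seq_var_le N vw))//= /F clamp_id; last lra.
by rewrite clamp_id ?lerB ?wle//; have := @bnode_itv R N 0 (leq0n N); lra.
Qed.

End VariationMeasures.

(** * Rectangular increments against the signed Stieltjes measure *)

Section StieltjesMeasureOfGrids.
Set Implicit Arguments.
Unset Strict Implicit.
Context {R : realType}.
Implicit Types (x y t a b e : R).
Local Notation mR := (measurableTypeR R).
Local Notation mR2 := (measurableTypeR R * measurableTypeR R)%type.

Lemma sum_indic_bnode N n x : (n <= N)%N ->
  \sum_(m < n) \1_(`]bnode N m, bnode N m.+1] : set R) x =
  \1_(`]bnode N 0, bnode N n] : set R) x :> R.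
Proof.
elim: n => [|n IH] nN.
  by rewrite big_ord0 indicE memNset// /= in_itv/=; lra.
rewrite big_ord_recr/= IH ?(ltnW nN)// !indicE.
have h1 : bnode N n < bnode N n.+1 :> R by apply: bnode_lt.
have h0 : bnode N 0 <= bnode N n :> R.
  by case: n {IH nN h1} => // n; rewrite ltW// bnode_lt.
rewrite !mem_setE !in_itv/=.
case: (ltP (bnode N 0) x) => x0 /=; case: (ltP (bnode N n) x) => xn /=;
  case: (leP x (bnode N n.+1)) => xn1 //=; rewrite ?addr0 ?add0r//; lra.
Qed.

Lemma sum_indic_bnode_le_weight1 N x :
  \sum_(m < N) \1_(`]bnode N m, bnode N m.+1] : set R) x <= weight1 x.
Proof.
rewrite sum_indic_bnode// indicE; case: (boolP (x \in _)) => [|_]; last exact: weight1_ge0.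
rewrite inE/= in_itv/= => x1; apply: weight1_ge1.
have := @bnode_itv R N 0 (leq0n N); have := @bnode_itv R N N (leqnn N); lra.
Qed.

Lemma clamp_bnode N j : (j <= N)%N -> clamp (bnode N j) = bnode N j :> R.
Proof. by move=> jN; apply: clamp_id; have := @bnode_itv R N j jN; lra. Qed.

(** Each increment is the charge of a half-open rectangle, so its modulus is at most the variation
    there. The rectangles are disjoint and inside the open square, so their indicators sum to at
    most the weight. *)
Lemma grid_variation_le (g : R * R -> R) M N : has_stieltjes_measure g ->
  ((\sum_(j < N) \sum_(i < M)
     `|rect_incr g (bnode M i) (bnode M i.+1) (bnode N j) (bnode N j.+1)|)%:E <=
   \int[charge_abs (stieltjes_measure g)]_(p in (square : set mR2)) (weight p)%:E)%E.
Proof.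
move=> Hg.
have : generated_by_increments g (stieltjes_measure g).
  by rewrite /stieltjes_measure; case: pselect => // e; exact: svalP (cid e).
move: (stieltjes_measure g) => nu gnu.
rewrite /charge_abs; set mu := charge_variation _.
pose rect (j : 'I_N) (i : 'I_M) : set mR2 :=
  `]bnode M i, bnode M i.+1] `*` `]bnode N j, bnode N j.+1].
have mrect j i : measurable (rect j i) by apply: measurableX; exact: measurable_itv.
apply: (@le_trans _ _ (\int[mu]_(p in (square : set mR2))
  (\sum_(j < N) \sum_(i < M) (\1_(rect j i) p)%:E))%E); last first.
  apply: ge0_le_lower_integral => p _.
    by apply: sume_ge0 => j _; apply: sume_ge0 => i _; rewrite lee_fin.
  under eq_bigr do rewrite sumEFin; rewrite sumEFin lee_fin.
  have -> : \sum_(j < N) \sum_(i < M) \1_(rect j i) p =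
    (\sum_(i < M) \1_(`]bnode M i, bnode M i.+1] : set R) p.1) *
    (\sum_(j < N) \1_(`]bnode N j, bnode N j.+1] : set R) p.2) :> R.
    rewrite mulr_sumr; apply: eq_bigr => j _; rewrite mulr_suml; apply: eq_bigr => i _.
    rewrite !indicE /rect -natrM mulnb; congr (nat_of_bool _)%:R.
    by apply/idP/andP => [|[]]; rewrite !inE/= => -[].
  apply: ler_pM; rewrite ?sum_indic_bnode_le_weight1//.
  - by apply: sumr_ge0.
  - by apply: sumr_ge0.
have msq : measurable (square : set mR2) by apply: measurableX; exact: measurable_itv.
rewrite ge0_integral_sum//; last 2 first.
  - move=> j; apply: emeasurable_sum => i; apply/measurable_EFinP.
    exact: measurable_indic.
  - by move=> j p _; apply: sume_ge0 => i _; rewrite lee_fin.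
rewrite -sumEFin; apply: lee_sum => j _.
rewrite ge0_integral_sum//; last first.
  by move=> i; apply/measurable_EFinP; exact: measurable_indic.
rewrite -sumEFin; apply: lee_sum => i _.
rewrite integral_indic//.
have [jN iM] := (ltn_ord j, ltn_ord i).
have := (@bnode_itv R N j (ltnW jN), @bnode_itv R N j.+1 jN).
have := (@bnode_itv R M i (ltnW iM), @bnode_itv R M i.+1 iM).
move=> [bi bi'] [bj bj'].
rewrite setIidl; last first.
  by move=> p [/=]; rewrite !in_itv/= => ? ?; split; rewrite /= in_itv/=; lra.
apply: le_trans (abse_charge_variation _ (mrect j i)).
have bS n m : bnode n m <= bnode n m.+1 :> R by rewrite ltW// bnode_lt.
by rewrite /rect gnu// !clamp_bnode ?(ltnW jN) ?(ltnW iM).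
Qed.

End StieltjesMeasureOfGrids.

(** * The roots of [T_n] and the tensor-product form of the approximant *)

Section GaussChebyshevApproximant.
Set Implicit Arguments.
Unset Strict Implicit.
Context {R : realType}.
Implicit Types (n d m i j : nat) (x y t a b e : R).

Lemma node_lt n i j : (i < j)%N -> (j < n)%N -> node n j < node n i :> R.
Proof.
move=> ij jn; have iN := ltn_trans ij jn.
rewrite /node ltr_cos ?in_itv/= ?node_angle_itv//.
rewrite /node_angle ltr_pM2r ?ltr_nat ?ltnS ?ltn_double//.
by rewrite divr_gt0 ?pi_gt0// ltr0n double_gt0 (leq_ltn_trans _ jn).
Qed.

Lemma node_inj n i j : (i < n)%N -> (j < n)%N -> node n i = node n j :> R -> i = j.
Proof.
move=> iN jN e; have [ij|ij|//] := ltngtP i j.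
  by have := node_lt ij jN; rewrite e ltxx.
by have := node_lt ij iN; rewrite e ltxx.
Qed.

Lemma root_cheb_poly_node n m : (m < n)%N -> root (cheb_poly n) (node n m : R).
Proof.
move=> mn; apply/rootP; rewrite cheb_polyE ?chebT_node//; last first.
  by rewrite cos_geN1 cos_le1.
have -> : n%:R * node_angle n m = m%:R * pi + pi / 2 :> R.
  rewrite /node_angle -(natr1 m.*2) -!mul2n !natrM; field.
  by rewrite pnatr_eq0 -lt0n (leq_ltn_trans _ mn).
by rewrite cosDpihalf sin_natM_pi oppr0.
Qed.

(* A further root would make [n + 1] roots for a polynomial of degree [n]. *)
Lemma chebT_rootsE n : chebT_roots n = [set node n m | m in `I_n] :> set R.
Proof.
apply/seteqP; split => [x [x1 Tx]|_ [m /= mn <-]]; last first.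
  split; first by rewrite in_itv/= cos_geN1 cos_le1.
  have /rootP := root_cheb_poly_node mn.
  by rewrite cheb_polyE// cos_geN1 cos_le1.
apply: contrapT => xn.
have [sz c0] := @size_coef_cheb_poly R n.
have p0 : cheb_poly n != 0 :> {poly R} by apply: contra_neq c0 => ->; rewrite coef0.
have := @max_poly_roots R (cheb_poly n) (x :: [seq node n m | m <- iota 0 n]) p0.
rewrite /= size_map size_iota => H.
suff : (n.+1 < size (cheb_poly n : {poly R}))%N by rewrite ltnNge sz.
apply: H.
  apply/andP; split.
    by apply/rootP; rewrite cheb_polyE//; rewrite in_itv/= in x1.
  by apply/allP => _ /mapP[m + ->]; rewrite mem_iota => /= mn; apply: root_cheb_poly_node.
apply/andP; split.
  apply/negP => /mapP[m]; rewrite mem_iota /= => mn xm.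
  by apply: xn; exists m.
rewrite map_inj_in_uniq ?iota_uniq// => i j; rewrite !mem_iota => /= iN jN.
exact: node_inj.
Qed.

Lemma fsbig_chebT_roots n (F : R -> R) :
  \sum_(x \in chebT_roots n) F x = \sum_(m < n) F (node n m).
Proof.
rewrite chebT_rootsE fsbig_image; last first.
  by move=> i j; rewrite !inE => iN jN; apply: node_inj.
by rewrite -fsbig_ord.
Qed.

Lemma cheb_approxE nx ny dx dy (f : R * R -> R) (p : R * R) :
  cheb_approx nx ny dx dy f p =
  cheb_proj ny dy (fun y => cheb_proj nx dx (fun x => f (x, y)) p.1) p.2.
Proof.
rewrite /cheb_approx big_mkord /cheb_proj /dcoef.
under eq_bigr do rewrite big_mkord.
rewrite exchange_big/=; apply: eq_bigr => j _.
under eq_bigr => i _.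
  rewrite /approx_coef fsbig_chebT_roots.
  under eq_bigr do rewrite fsbig_chebT_roots.
  over.
rewrite -mulr_suml; congr (_ * _).
under [in RHS]eq_bigr do rewrite mulr_suml.
rewrite exchange_big/= !mulr_sumr; apply: eq_bigr => i _.
rewrite exchange_big/= !mulr_sumr mulr_suml; apply: eq_bigr => s _.
rewrite !(mulr_sumr, mulr_suml); apply: eq_bigr => m _.
by rewrite !chebT_node// invfM; ring.
Qed.

End GaussChebyshevApproximant.

(** * Linearity and regularity of iterated derivatives *)

Section SmoothFunctions.
Set Implicit Arguments.
Unset Strict Implicit.
Context {R : realType}.
Implicit Types (n k : nat) (h g v w : R -> R) (x y t a b c e : R).

(** Existence and formula are proved together: the next derivative exists because the formula for
    the current one holds in a whole neighbourhood of [a]. *)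
Lemma nderivable_lin n c h g a : nderivable n h a -> nderivable n g a ->
  nderivable n (fun t => h t + c * g t) a /\
  derive1n n (fun t => h t + c * g t) a = derive1n n h a + c * derive1n n g a.
Proof.
elim: n a => [//|n IH] a [nh dh] [ng dg].
have E : \forall t \near a, nderivable n (fun t => h t + c * g t) t /\
    derive1n n h t + c * derive1n n g t = derive1n n (fun t => h t + c * g t) t.
  near=> t; have [] := IH t; last by move=> ? ->.
  - by near: t.
  - by near: t.
have D : is_derive a 1 (derive1n n (fun t => h t + c * g t))
    (derive1n n.+1 h a + c * derive1n n.+1 g a).
  apply: (near_eq_is_derive (f := fun t => derive1n n h t + c * derive1n n g t)).
    by apply: filterS E => t [].
  have dh' : is_derive a 1 (derive1n n h) (derive1n n.+1 h a).
    by rewrite derive1nS derive1E; apply: DeriveDef.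
  have dg' : is_derive a 1 (derive1n n g) (derive1n n.+1 g a).
    by rewrite derive1nS derive1E; apply: DeriveDef.
  exact: is_deriveD dh' (is_deriveZ c dg').
split; last by rewrite derive1nS derive1E; apply: derive_val.
by split; [apply: filterS E => t []|have [] := D].
Unshelve. all: by end_near. Qed.

Lemma cont11_lin c v w : cont11 v -> cont11 w -> cont11 (fun t => v t + c * w t).
Proof.
move=> cv cw x e x1 e0.
have e2 : 0 < e / 2 by rewrite divr_gt0.
have c0 : 0 < `|c| + 1 by rewrite ltr_wpDl.
have e3 : 0 < e / 2 / (`|c| + 1) by rewrite divr_gt0.
have [d d0 Hd] := cv x _ x1 e2; have [r r0 Hr] := cw x _ x1 e3.
exists (Num.min d r); first by rewrite lt_min d0.
move=> t t1; rewrite lt_min => /andP[td tr].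
have -> : v t + c * w t - (v x + c * w x) = (v t - v x) + c * (w t - w x) by ring.
rewrite (le_lt_trans (ler_normD _ _))// [ltRHS]splitr ltrD ?Hd// normrM.
have := Hr t t1 tr; rewrite ltr_pdivlMr// => H.
by apply: le_lt_trans H; rewrite mulrC ler_wpM2l// lerDl.
Qed.

Lemma eq_cont11 v w : (forall x, -1 <= x <= 1 -> v x = w x) -> cont11 v -> cont11 w.
Proof.
move=> vw cv x e x1 e0; have [d d0 H] := cv x e x1 e0.
by exists d => // t t1 tx; rewrite -!vw// H.
Qed.

Definition smooth11 n h := (forall x, -1 <= x <= 1 -> nderivable n h x) /\ cont11 (derive1n n h).

Lemma smooth11_lin n c h g : smooth11 n h -> smooth11 n g ->
  smooth11 n (fun t => h t + c * g t).
Proof.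
move=> [dh ch] [dg cg]; split=> [x x1|].
  by have [] := nderivable_lin c (dh x x1) (dg x x1).
apply: eq_cont11 (cont11_lin c ch cg) => x x1.
by have [_ ->] := nderivable_lin c (dh x x1) (dg x x1).
Qed.

(** The projection in [x] is a finite combination of the slices of [f] at the nodes, with
    coefficients independent of [y], so differentiation in [y] commutes with it. *)
Lemma smooth11_cheb_remainder n m d (f : R * R -> R) (x : R) :
  -1 <= x <= 1 ->
  (forall x, -1 <= x <= 1 -> smooth11 n (fun y => f (x, y))) ->
  let h y := f (x, y) - cheb_proj m d (fun x => f (x, y)) x in
  smooth11 n h /\ forall y, -1 <= y <= 1 ->
    derive1n n h y = partial 0 n f (x, y) - cheb_proj m d (fun x => partial 0 n f (x, y)) x.
Proof.
move=> x1 sf h.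
pose K (i : 'I_m) : R := \sum_(j < d.+1) half0 j * (2 / m%:R) *
     cos (j%:R * node_angle m i) * chebT j x.
have node1 i : -1 <= @node R m i <= 1 by rewrite cos_geN1 cos_le1.
have -> : h = fun y => f (x, y) - \sum_(i < m) K i * f (node m i, y).
  by apply/funext => y; rewrite /h cheb_projE.
have P (r : seq 'I_m) : let g y := f (x, y) - \sum_(i <- r) K i * f (node m i, y) in
  smooth11 n g /\ forall y, -1 <= y <= 1 ->
    derive1n n g y = partial 0 n f (x, y) - \sum_(i <- r) K i * partial 0 n f (node m i, y).
  elim: r => [|i r [sg dg]].
    rewrite /= (_ : (fun y => _) = fun y => f (x, y)); last first.
      by apply/funext => y; rewrite big_nil subr0.
    by split; [exact: sf|move=> y y1; rewrite big_nil subr0].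
  rewrite /= (_ : (fun y => _) = fun y => (f (x, y) - \sum_(i <- r) K i * f (node m i, y))
      + (- K i) * f (node m i, y)); last first.
    by apply/funext => y; rewrite big_cons; ring.
  split; first by apply: smooth11_lin => //; exact: sf.
  move=> y y1; rewrite big_cons.
  have [_ ->] := nderivable_lin (- K i) (sg.1 y y1) ((sf _ (node1 i)).1 y y1).
  rewrite dg//.
  rewrite (_ : derive1n n (fun y => f (node m i, y)) y = partial 0 n f (node m i, y))//.
  ring.
have [sg dg] := P (index_enum 'I_m); split => // y y1.
by rewrite dg// cheb_projE.
Qed.

(** [0 < k] makes [derive1n k h] itself a derivative, so that a control of its oscillation forces
    its continuity. *)
Lemma smooth11_control k h v w : (0 < k)%N ->
  (forall x, -1 <= x <= 1 -> nderivable k h x) ->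
  (forall x, -1 <= x <= 1 -> derive1n k h x = v x) ->
  (forall x y, -1 <= x -> x <= y -> y <= 1 -> `|v y - v x| <= w y - w x) ->
  smooth11 k h.
Proof.
case: k => // k _ dh hv vw; split => //.
apply: (@derivative_cont11 _ (derive1n k h) _ w) => [x x1|x y x1 xy y1].
  exact: nderivable_is_derive (dh x x1).
by rewrite !hv ?vw//; lra.
Qed.

Lemma smooth11_bounded_variation k h : (0 < k)%N ->
  (forall x, -1 <= x <= 1 -> nderivable k h x) ->
  bounded_variation (-1) 1 (derive1n k h) -> smooth11 k h.
Proof.
move=> k0 dh /bounded_variation_control; exact: smooth11_control.
Qed.

Lemma smooth11_continuous k h : (0 < k)%N -> (forall x, -1 <= x <= 1 -> nderivable k h x) ->
  {within `[-1, 1], continuous h}.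
Proof.
move=> k0 dh; apply: derivable_within_continuous => x; rewrite in_itv/= => x1.
by have [] := nderivable_is_derive k0 (dh x x1).
Qed.

Lemma cheb_error_le k d n h (V : \bar R) : (0 < k)%N -> (k <= d < n)%N ->
  smooth11 k h ->
  (forall N, ((seq_var N (derive1n k h \o bnode N))%:E <= V)%E) ->
  (\int[lebesgue_measure]_(x in `[(-1)%R, 1%R]) `|h x - cheb_proj n d h x|%:E <=
   (cheb_const k d)%:E * V)%E.
Proof.
move=> k0 kdn [dh ch] SV; apply/lee_addgt0Pr => e e0.
have [N0 H] := cheb_proj_error k0 kdn dh ch e0.
apply: le_trans (H N0 (leqnn _)) _.
rewrite EFinD leeD2r// EFinM lee_wpmul2l//.
rewrite lee_fin /cheb_const divr_ge0 ?divr_ge0 ?mulr_ge0 ?pi_ge0 ?exprn_ge0//.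
Qed.

(** Vitali variation sees only rectangular increments and says nothing about a single slice; the
    difference of two slices is one row of the grid with levels [-1], [y], [y'], [1]. The strict
    inequalities keep these levels distinct. *)
Lemma vitali_bounded_variation_slice (g : R * R -> R) y y' :
  vitali_bounded_variation g -> -1 < y -> y < y' -> y' < 1 ->
  bounded_variation (-1) 1 (fun x => g (x, y') - g (x, y)).
Proof.
move=> [M HM] y1 yy' y'1; exists M => _ [s sP <-].
apply: (@le_trans _ _ (vitali_sum g s [:: y; y'; 1])); last first.
  apply: HM; exists (s, [:: y; y'; 1]) => //=; split => //.
  by rewrite /itv_partition/= y1 yy' y'1.
rewrite /variation /vitali_sum; apply: ler_sum_nat => p /andP[_ ps].
have s1 : nth 1 s p = nth 0 s p by apply: set_nth_default.
have s2 : nth 1 (-1 :: s) p = nth 0 (-1 :: s) p by apply: set_nth_default; exact: ltnW.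
rewrite /= big_ltn// big_ltn// big_ltn// big_geq//= addr0.
apply: le_trans (ler_wpDl _ (ler_wpDr _ _)); last exact: lexx.
- by rewrite s1 s2 /rect_incr le_eqVlt; apply/orP; left; apply/eqP; congr (Num.norm _); ring.
- by [].
- by [].
Qed.

End SmoothFunctions.

(** * Measurability, Tonelli and the weighted integral *)

Section IteratedIntegrals.
Set Implicit Arguments.
Unset Strict Implicit.
Context {R : realType}.
Local Notation mR := (measurableTypeR R).
Local Notation mR2 := (measurableTypeR R * measurableTypeR R)%type.
Local Notation lambda := (@lebesgue_measure R).
Local Notation D := (`[(-1)%R, 1%R]%classic : set mR).
Implicit Types (g : R * R -> R).

Lemma measurable_square : measurable (square : set mR2).
Proof. by apply: measurableX; exact: measurable_itv. Qed.

Lemma measurable_clamp : measurable_fun setT (clamp : mR -> mR).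
Proof. by apply: measurable_maxr => //; exact: measurable_minr. Qed.

(* Clamping turns measurability on the square into measurability on the whole
   plane, which sections inherit for free. *)
Definition measurable_on_square g :=
  measurable_fun setT (fun p : mR2 => g (clamp p.1, clamp p.2) : mR).

Let abs_on_square g (p : mR2) : \bar R := ((fun p => `|g p|%:E) \_ (square : set mR2))%E p.

Let abs_on_square_measurable g : measurable_on_square g ->
  measurable_fun setT (abs_on_square g).
Proof.
move=> mg; apply/(measurable_restrictT _ measurable_square).
apply: (eq_measurable_fun (fun p : mR2 => `|g (clamp p.1, clamp p.2)|%:E)).
  move=> [x y]; rewrite inE => -[/=]; rewrite !in_itv/= => x1 y1.
  by rewrite !clamp_id.
apply: measurable_funTS; apply/measurable_EFinP; exact: measurableT_comp.
Qed.

Let abs_on_square_ge0 g p : (0 <= abs_on_square g p)%E.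
Proof. by rewrite /abs_on_square /patch; case: ifPn => _ //; rewrite lee_fin. Qed.

Let L1normE g : L1norm g = (\int[lambda \x lambda]_p abs_on_square g p)%E.
Proof. by rewrite /L1norm integral_mkcond. Qed.

Let sectionF g : fubini_F lambda (abs_on_square g) =
  ((fun x => \int[lambda]_(y in D) `|g (x, y)|%:E) \_ D)%E.
Proof.
apply/funext => x; rewrite /fubini_F [in RHS]/patch.
case: ifPn => [|] xD.
  rewrite [RHS]integral_mkcond; apply: eq_integral => y _.
  rewrite /abs_on_square /patch; congr (if _ then _ else _).
  by apply/idP/idP; rewrite !inE; [case|split=> //]; rewrite inE in xD.
rewrite integral0_eq// => y _; rewrite /abs_on_square /patch ifF//.
by apply/negbTE; apply: contra xD; rewrite !inE => -[].
Qed.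

Let sectionG g : fubini_G lambda (abs_on_square g) =
  ((fun y => \int[lambda]_(x in D) `|g (x, y)|%:E) \_ D)%E.
Proof.
apply/funext => y; rewrite /fubini_G [in RHS]/patch.
case: ifPn => [|] yD.
  rewrite [RHS]integral_mkcond; apply: eq_integral => x _.
  rewrite /abs_on_square /patch; congr (if _ then _ else _).
  by apply/idP/idP; rewrite !inE; [case|split=> //]; rewrite inE in yD.
rewrite integral0_eq// => x _; rewrite /abs_on_square /patch ifF//.
by apply/negbTE; apply: contra yD; rewrite !inE => -[].
Qed.

Lemma L1norm_fubini1 g : measurable_on_square g ->
  L1norm g = (\int[lambda]_(x in D) \int[lambda]_(y in D) `|g (x, y)|%:E)%E /\
  measurable_fun D (fun x => \int[lambda]_(y in D) `|g (x, y)|%:E)%E.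
Proof.
move=> /abs_on_square_measurable mg; split.
  by rewrite L1normE fubini_tonelli1 ?sectionF -?integral_mkcond.
apply/measurable_restrictT => //; rewrite -sectionF.
by apply: measurable_fun_fubini_tonelli_F => // p; exact: abs_on_square_ge0.
Qed.

Lemma L1norm_fubini2 g : measurable_on_square g ->
  L1norm g = (\int[lambda]_(y in D) \int[lambda]_(x in D) `|g (x, y)|%:E)%E /\
  measurable_fun D (fun y => \int[lambda]_(x in D) `|g (x, y)|%:E)%E.
Proof.
move=> /abs_on_square_measurable mg; split.
  by rewrite L1normE fubini_tonelli2 ?sectionG -?integral_mkcond.
apply/measurable_restrictT => //; rewrite -sectionG.
by apply: measurable_fun_fubini_tonelli_G => // p; exact: abs_on_square_ge0.
Qed.

Lemma L1norm_triangle g h1 h2 h3 : measurable_on_square h1 ->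
  measurable_on_square h2 -> measurable_on_square h3 ->
  (forall p, g p = h1 p + h2 p - h3 p) ->
  (L1norm g <= L1norm h1 + L1norm h2 + L1norm h3)%E.
Proof.
move=> /abs_on_square_measurable m1 /abs_on_square_measurable m2
  /abs_on_square_measurable m3 gE.
have ge0 := abs_on_square_ge0.
rewrite !L1normE -!ge0_integralD//; last 2 first.
- by move=> p _; rewrite adde_ge0.
- exact: emeasurable_funD.
apply: ge0_le_lower_integral => // p _.
rewrite /abs_on_square /patch; case: ifPn => _; last by rewrite !adde0.
by rewrite gE -!EFinD lee_fin (le_trans (ler_normB _ _))// lerD2r ler_normD.
Qed.

Lemma measurable_on_squareB g h : measurable_on_square g -> measurable_on_square h ->
  measurable_on_square (fun p => g p - h p).
Proof. exact: measurable_funB. Qed.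

Let measurable_chebT j : measurable_fun setT (fun x : mR => chebT j (clamp x) : mR).
Proof.
rewrite (_ : (fun _ => _) = horner (cheb_poly j) \o clamp); last first.
  by apply/funext => x /=; rewrite cheb_polyE// clamp_itv.
apply: measurableT_comp measurable_clamp.
by apply: continuous_measurable_fun; exact: continuous_horner.
Qed.

Lemma measurable_on_square_projx n d g : measurable_on_square g ->
  measurable_on_square (fun p => cheb_proj n d (fun x => g (x, p.2)) p.1).
Proof.
move=> mg; rewrite /measurable_on_square /cheb_proj /dcoef /=.
apply: measurable_sum => j; apply: measurable_funM; last first.
  exact: measurableT_comp (measurable_chebT j) measurable_fst.
apply: measurable_funM => //; apply: measurable_funM => //.
apply: measurable_sum => m; apply: measurable_funM => //.
rewrite (_ : (fun _ => _) = (fun p : mR2 => g (clamp p.1, clamp p.2)) \o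
  (fun p : mR2 => (node n m : mR, p.2))); last first.
  by apply/funext => p /=; rewrite [clamp (node _ _)]clamp_id// cos_geN1 cos_le1.
apply: measurableT_comp => //; apply: measurable_fun_pair => //.
Qed.

Lemma measurable_on_square_projy n d g : measurable_on_square g ->
  measurable_on_square (fun p => cheb_proj n d (fun y => g (p.1, y)) p.2).
Proof.
move=> mg; rewrite /measurable_on_square /cheb_proj /dcoef /=.
apply: measurable_sum => j; apply: measurable_funM; last first.
  exact: measurableT_comp (measurable_chebT j) measurable_snd.
apply: measurable_funM => //; apply: measurable_funM => //.
apply: measurable_sum => m; apply: measurable_funM => //.
rewrite (_ : (fun _ => _) = (fun p : mR2 => g (clamp p.1, clamp p.2)) \o
  (fun p : mR2 => (p.1, node n m : mR))); last first.
  by apply/funext => p /=; rewrite [clamp (node _ _)]clamp_id// cos_geN1 cos_le1.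
apply: measurableT_comp => //; apply: measurable_fun_pair => //.
Qed.

Lemma measurable_cheb_remainder n d (h : R -> R) : {within `[-1, 1], continuous h} ->
  measurable_fun D (fun x => (h x - cheb_proj n d h x) : mR).
Proof.
move=> ch; apply: measurable_funB.
  by apply: subspace_continuous_measurable_fun.
apply: (eq_measurable_fun (fun x => cheb_proj n d h (clamp x))).
  by move=> x; rewrite inE/= in_itv/= => x1; rewrite clamp_id.
apply: measurable_funTS; rewrite /cheb_proj; apply: measurable_sum => j.
by apply: measurable_funM => //; exact: measurable_chebT.
Qed.

(** For [i = j = 0] the integrand is [f (cos t.1, cos t.2)]; composing it with [acos], measurable
    because monotone, recovers [f] on the square. *)
Lemma cheb_coef_exists_measurable f : cheb_coef_exists f 0 0 -> measurable_on_square f.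
Proof.
move=> /measurable_int mf; rewrite /measurable_on_square.
have m0pi : measurable (`[0, pi] `*` `[0, pi] : set mR2).
  by apply: measurableX; exact: measurable_itv.
have acos1 (z : R) : acos (clamp z) \in `[0, pi].
  by rewrite in_itv/= (acos_ge0 (clamp_itv z)) (acos_lepi (clamp_itv z)).
have mac : measurable_fun setT (fun x : mR => acos (clamp x) : mR).
  apply: nonincreasing_measurable => // x y xy.
  have : cos (acos (clamp x)) <= cos (acos (clamp y)).
    by rewrite !acosK ?in_itv/= ?clamp_itv// clamp_le.
  by rewrite !leNgt; apply: contra => H; rewrite ltr_cos.
have := measurable_comp m0pi _ mf (_ : measurable_fun setT
  (fun p : mR2 => (acos (clamp p.1) : mR, acos (clamp p.2) : mR))).
have -> : (fun t : R * R => (f (cos t.1, cos t.2) * cos (0%:R * t.1) * cos (0%:R * t.2))%:E) \o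
  (fun p : mR2 => (acos (clamp p.1) : mR, acos (clamp p.2) : mR)) =
  EFin \o (fun p => f (clamp p.1, clamp p.2)).
  by apply/funext => p /=; rewrite !mul0r !cos0 !mulr1 !acosK ?in_itv/= ?clamp_itv.
move=> H; apply/measurable_EFinP; apply: H.
  by move=> _ [p _ <-] /=; split; rewrite /= acos1.
apply: measurable_fun_pair.
  exact: measurableT_comp mac measurable_fst.
exact: measurableT_comp mac measurable_snd.
Qed.

(* The weight is at least [1] off the endpoints, which are negligible. *)
Lemma integral_le_weighted (c : R) (A V : R -> \bar R) : 0 < c ->
  measurable_fun D A -> (forall x, D x -> 0 <= A x)%E ->
  (forall x, D x -> 0 <= V x)%E ->
  (forall x, D x -> A x <= c%:E * V x)%E ->
  (\int[lambda]_(x in D) A x <= c%:E * \int[lambda]_(x in D) (V x * (weight1 x)%:E))%E.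
Proof.
move=> c0 mA A0 V0 AV.
have oo : `](-1)%R, 1%R[ `<=` D by move=> x /=; rewrite !in_itv/=; lra.
have moo : measurable_fun (`](-1)%R, 1%R[ : set mR) A by apply: measurable_funS mA.
rewrite integral_itv_bndoo//.
(* The constant is moved to the side of [A], which is known to be measurable; [V] is not. *)
have -> : (\int[lambda]_(x in `](-1)%R, 1%R[) A x =
    c%:E * \int[lambda]_(x in `](-1)%R, 1%R[) (c^-1%:E * A x))%E.
  rewrite ge0_integralZl//; last 2 first.
  - by move=> x xo; apply: A0; exact: oo.
  - by rewrite lee_fin invr_ge0 ltW.
  by rewrite muleA -EFinM mulfV ?gt_eqF// mul1e.
rewrite lee_wpmul2l ?lee_fin ?(ltW c0)//.
rewrite integral_mkcond [leRHS]integral_mkcond.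
apply: ge0_le_lower_integral => x _; rewrite /patch.
  case: ifPn => //; rewrite inE => xo; rewrite mule_ge0 ?A0//; last exact: oo.
  by rewrite lee_fin invr_ge0 ltW.
case: (boolP (x \in `](-1)%R, 1%R[%classic)) => [|_]; last first.
  by case: ifPn => //; rewrite inE => xD; rewrite mule_ge0 ?V0// lee_fin weight1_ge0.
rewrite inE => xo; rewrite ifT; last by rewrite inE; exact: oo.
rewrite -[leRHS]mul1e -(mulVf (lt0r_neq0 c0)) EFinM -muleA lee_wpmul2l//.
  by rewrite lee_fin invr_ge0 ltW.
apply: le_trans (AV _ (oo _ xo)) _; rewrite lee_wpmul2l ?lee_fin ?(ltW c0)//.
rewrite -[leLHS]mule1 lee_wpmul2l ?V0//; first exact: oo.
by rewrite lee_fin weight1_ge1//; move: xo; rewrite /= in_itv/=.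
Qed.

End IteratedIntegrals.

(** * The three remainders and the final constant *)

Section BivariateError.
Set Implicit Arguments.
Unset Strict Implicit.
Context {R : realType}.
Local Notation mR := (measurableTypeR R).
Local Notation lambda := (@lebesgue_measure R).
Local Notation D := (`[(-1)%R, 1%R]%classic : set mR).
Implicit Types (f : R * R -> R) (k l d n : nat).

Lemma cheb_const_gt0 k d : (0 < k)%N -> 0 < cheb_const k d :> R.
Proof.
move=> k0; rewrite /cheb_const divr_gt0 ?divr_gt0 ?mulr_gt0 ?pi_gt0 ?exprn_gt0 ?ltr0n//.
by rewrite addn1.
Qed.

Lemma x_remainder_le k d n f : (0 < k)%N -> (k <= d < n)%N ->
  measurable_on_square f ->
  (forall y, -1 <= y <= 1 -> smooth11 k (fun x => f (x, y))) ->
  (forall y, -1 <= y <= 1 -> bounded_variation (-1) 1 (fun x => partial k 0 f (x, y))) ->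
  (L1norm (fun p => f p - cheb_proj n d (fun x => f (x, p.2)) p.1)%R <=
   (cheb_const k d)%:E * Vx k f)%E.
Proof.
move=> k0 kdn mf sf bf.
have [-> mA] := L1norm_fubini2 (measurable_on_squareB mf (measurable_on_square_projx n d mf)).
have SV y N : -1 <= y <= 1 -> ((seq_var N (derive1n k (fun x => f (x, y)) \o bnode N))%:E <=
    \int[variation_measure (fun x => partial k 0 f (x, y))]_(x in D) (weight1 x)%:E)%E.
  by move=> y1; apply: seq_var_le_variation_measure (bf y y1); case: (sf y y1).
apply: integral_le_weighted => //.
- exact: cheb_const_gt0.
- by move=> y _; apply: integral_ge0 => x _; rewrite lee_fin.
(* Nonnegativity of the inner integral is read off the estimate for the grid [N = 0], since the
   variation measure is declared only as a set function. *)
- move=> y; rewrite /= in_itv/= => y1; apply: le_trans (SV y 0%N y1).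
  by rewrite lee_fin sumr_ge0.
- move=> y; rewrite /= in_itv/= => y1.
  by apply: cheb_error_le => //; [exact: sf|move=> N; exact: SV].
Qed.

Lemma y_remainder_le l d n f : (0 < l)%N -> (l <= d < n)%N ->
  measurable_on_square f ->
  (forall x, -1 <= x <= 1 -> smooth11 l (fun y => f (x, y))) ->
  (forall x, -1 <= x <= 1 -> bounded_variation (-1) 1 (fun y => partial 0 l f (x, y))) ->
  (L1norm (fun p => f p - cheb_proj n d (fun y => f (p.1, y)) p.2)%R <=
   (cheb_const l d)%:E * Vy l f)%E.
Proof.
move=> l0 ldn mf sf bf.
have [-> mA] := L1norm_fubini1 (measurable_on_squareB mf (measurable_on_square_projy n d mf)).
have SV x N : -1 <= x <= 1 -> ((seq_var N (derive1n l (fun y => f (x, y)) \o bnode N))%:E <=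
    \int[variation_measure (fun y => partial 0 l f (x, y))]_(y in D) (weight1 y)%:E)%E.
  by move=> x1; apply: seq_var_le_variation_measure (bf x x1); case: (sf x x1).
apply: integral_le_weighted => //.
- exact: cheb_const_gt0.
- by move=> x _; apply: integral_ge0 => y _; rewrite lee_fin.
- move=> x; rewrite /= in_itv/= => x1; apply: le_trans (SV x 0%N x1).
  by rewrite lee_fin sumr_ge0.
- move=> x; rewrite /= in_itv/= => x1.
  by apply: cheb_error_le => //; [exact: sf|move=> N; exact: SV].
Qed.

Lemma le_limn_einf (a : \bar R) (u : R^nat) :
  (forall e, 0 < e -> exists N0, forall N, (N0 <= N)%N -> (a <= (u N + e)%:E)%E) ->
  (a <= limn_einf (EFin \o u))%E.
Proof.
move=> H; rewrite limn_einf_lim (cvg_lim _ (@cvg_einfs_sup _ _))//.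
apply/lee_addgt0Pr => e e0; have [N0 HN] := H e e0.
rewrite -leeBlDr//; apply: (@le_trans _ _ (einfs (EFin \o u) N0)); last first.
  by apply: ereal_sup_ubound; exists N0.
apply/ereal_infP => _ [N /= N0N <-].
by rewrite EFinN leeBlDr// -EFinD HN.
Qed.

Lemma limn_einf_le (u : (\bar R)^nat) (b : \bar R) :
  (forall N, u N <= b)%E -> (limn_einf u <= b)%E.
Proof.
move=> ub; rewrite limn_einf_lim (cvg_lim _ (@cvg_einfs_sup _ _))//.
apply: ge_ereal_sup => _ [N _ <-]; apply: le_trans (ub N).
by apply: ereal_inf_lbound; exists N => /=.
Qed.

Section MixedRemainder.
Variables (f : R * R -> R) (k l dx dy nx ny : nat).
Hypotheses (k0 : (0 < k)%N) (l0 : (0 < l)%N).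
Hypotheses (kdn : (k <= dx < nx)%N) (ldn : (l <= dy < ny)%N).
Hypothesis mf : measurable_on_square f.
Hypothesis sf : forall x, -1 <= x <= 1 -> smooth11 l (fun y => f (x, y)).
Hypothesis fkl : forall p, square p -> partial_exists k l f p.
Hypothesis bf : vitali_bounded_variation (partial k l f).
Hypothesis hf : has_stieltjes_measure (partial k l f).

(** Increments of [f_{y^l}] rather than single slices: Vitali variation controls the [x]-derivatives
    of the former only. *)
Let u N m x := partial 0 l f (x, bnode N m.+1) - partial 0 l f (x, bnode N m).

Let u_smooth N m : (m < N)%N -> smooth11 k (u N m) /\
  forall x, -1 <= x <= 1 -> derive1n k (u N m) x =
    partial k l f (x, bnode N m.+1) - partial k l f (x, bnode N m).
Proof.
move=> mN.
have b1 := @bnode_itv R N m (ltnW mN); have b2 := @bnode_itv R N m.+1 mN.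
have nd x j : -1 <= x <= 1 -> (j <= N)%N -> nderivable k (fun x => partial 0 l f (x, bnode N j)) x.
  move=> x1 jN; have := @fkl (x, bnode N j) _; case=> //.
  split; rewrite /= in_itv/= ?x1//.
  by have /andP[/ltW -> /ltW ->] := @bnode_itv R N j jN.
have uE : u N m = fun x => partial 0 l f (x, bnode N m.+1) + (-1) * partial 0 l f (x, bnode N m).
  by apply/funext => x; rewrite mulN1r.
have H x : -1 <= x <= 1 -> nderivable k (u N m) x /\ derive1n k (u N m) x =
    partial k l f (x, bnode N m.+1) - partial k l f (x, bnode N m).
  move=> x1; rewrite uE.
  have [n1 ->] := nderivable_lin (-1) (nd x m.+1 x1 mN) (nd x m x1 (ltnW mN)).
  by split => //; rewrite mulN1r.
split; last by move=> x x1; have [] := H x x1.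
have bv : bounded_variation (-1) 1
    (fun x => partial k l f (x, bnode N m.+1) - partial k l f (x, bnode N m)).
  apply: vitali_bounded_variation_slice => //; first by case/andP: b1.
    exact: bnode_lt.
  by case/andP: b2.
apply: smooth11_control (bounded_variation_control bv) => // x x1; last first.
  by have [] := H x x1.
by have [] := H x x1.
Qed.

(** For fixed [x], this is the grid variation in [y] of the [l]-th [y]-derivative of the
    [x]-remainder, with the projection moved inside the increments by linearity. *)
Let S N x := \sum_(m < N) `|u N m x - cheb_proj nx dx (u N m) x|.

Let mS N : measurable_fun D (S N : mR -> mR).
Proof.
apply: measurable_sum => m; apply: measurableT_comp => //.
apply: measurable_cheb_remainder.
have [[dm _] _] := u_smooth (ltn_ord m).
exact: smooth11_continuous k0 dm.
Qed.

Let integral_S N :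
  (\int[lambda]_(x in D) (S N x)%:E <= (cheb_const k dx)%:E * Vxy k l f)%E.
Proof.
have -> : (\int[lambda]_(x in D) (S N x)%:E =
   \sum_(m < N) \int[lambda]_(x in D) `|u N m x - cheb_proj nx dx (u N m) x|%:E)%E.
  rewrite -ge0_integral_sum//.
  - by apply: eq_integral => x _; rewrite sumEFin.
  - move=> m; apply/measurable_EFinP; apply: measurableT_comp => //.
    apply: measurable_cheb_remainder.
    have [[dm _] _] := u_smooth (ltn_ord m).
    exact: smooth11_continuous k0 dm.
apply/lee_addgt0Pr => e e0.
(* [N.+1] instead of [N] keeps the division meaningful for [N = 0]. *)
have e1 : 0 < e / N.+1%:R by rewrite divr_gt0.
have /choice[N0 HN0] : forall m : 'I_N, exists N0, forall M, (N0 <= M)%N ->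
    (\int[lambda]_(x in D) `|u N m x - cheb_proj nx dx (u N m) x|%:E <=
     (cheb_const k dx * seq_var M (derive1n k (u N m) \o bnode M) + e / N.+1%:R)%:E)%E.
  move=> m; have [[dm cm] _] := u_smooth (ltn_ord m).
  by have [M HM] := cheb_proj_error k0 kdn dm cm e1; exists M.
pose M := \max_m N0 m.
apply: (@le_trans _ _ (\sum_(m < N)
    (cheb_const k dx * seq_var M (derive1n k (u N m) \o bnode M) + e / N.+1%:R)%:E)%E).
  by apply: lee_sum => m _; apply: HN0; exact: leq_bigmax.
rewrite sumEFin big_split/= -mulr_sumr EFinD leeD//; last first.
  rewrite lee_fin sumr_const card_ord -[leLHS]mulr_natl mulrCA ger_pMr//.
  by rewrite ler_pdivrMr// mul1r ler_nat.
rewrite EFinM lee_wpmul2l ?lee_fin ?(ltW (cheb_const_gt0 _ k0))//.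
apply: le_trans (grid_variation_le M N hf); rewrite lee_fin.
apply: ler_sum => m _; apply: ler_sum => i _.
have [_ dE] := u_smooth (ltn_ord m).
have bi : -1 <= @bnode R M i <= 1.
  by have /andP[/ltW -> /ltW ->] := @bnode_itv R M i (ltnW (ltn_ord i)).
have bi1 : -1 <= @bnode R M i.+1 <= 1.
  by have /andP[/ltW -> /ltW ->] := @bnode_itv R M i.+1 (ltn_ord i).
rewrite /= !dE// le_eqVlt; apply/orP; left; apply/eqP; congr (Num.norm _).
by rewrite /rect_incr; ring.
Qed.

Let r p := f p - cheb_proj nx dx (fun x => f (x, p.2)) p.1.

Lemma mixed_remainder_le :
  (L1norm (fun p => r p - cheb_proj ny dy (fun y => r (p.1, y)) p.2)%R <=
   (cheb_const l dy)%:E * ((cheb_const k dx)%:E * Vxy k l f))%E.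
Proof.
have mr : measurable_on_square r.
  exact: measurable_on_squareB (measurable_on_square_projx nx dx mf).
have [-> _] := L1norm_fubini1 (measurable_on_squareB mr (measurable_on_square_projy ny dy mr)).
have c0 := ltW (cheb_const_gt0 dy l0 : 0 < _ :> R).
have S0 N x : 0 <= cheb_const l dy * S N x.
  by rewrite mulr_ge0// sumr_ge0.
have mcS N : measurable_fun D (fun x => cheb_const l dy * S N x : mR).
  by apply: measurable_funM => //; exact: mS.
(* The rank from which the univariate estimate holds depends on [x]; the lower limit removes it
   pointwise, and Fatou's lemma then takes it out of the integral. *)
apply: (@le_trans _ _ (\int[lambda]_(x in D)
    limn_einf (fun N => (cheb_const l dy * S N x)%:E))%E).
  apply: ge0_le_lower_integral => x; rewrite /= in_itv/= => x1.
    by apply: integral_ge0 => y _; rewrite lee_fin.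
  apply: le_limn_einf => e e0.
  have [[dr cr] dE] := smooth11_cheb_remainder nx dx x1 sf.
  have [N0 HN] := cheb_proj_error l0 ldn dr cr e0.
  exists N0 => N N0N; apply: le_trans (HN N N0N) _.
  rewrite lee_fin lerD2r ler_wpM2l//; apply: ler_sum => m _.
  have bm : -1 <= @bnode R N m <= 1.
    by have /andP[/ltW -> /ltW ->] := @bnode_itv R N m (ltnW (ltn_ord m)).
  have bm1 : -1 <= @bnode R N m.+1 <= 1.
    by have /andP[/ltW -> /ltW ->] := @bnode_itv R N m.+1 (ltn_ord m).
  rewrite /= !dE// /u cheb_projB le_eqVlt; apply/orP; left; apply/eqP; congr (Num.norm _).
  by ring.
apply: le_trans (fatou _ _ _ _) _ => //.
- by move=> N; apply/measurable_EFinP; exact: mcS.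
- by move=> N x _; rewrite lee_fin.
apply: limn_einf_le => N.
under eq_integral do rewrite EFinM.
rewrite ge0_integralZl//.
- by rewrite lee_wpmul2l ?integral_S// lee_fin.
- by apply/measurable_EFinP; exact: mS.
- by move=> x _; rewrite lee_fin sumr_ge0.
Qed.

End MixedRemainder.

Lemma cheb_const_sum_le k l dx dy : (0 < k)%N -> (0 < l)%N -> (k <= dx)%N -> (l <= dy)%N ->
  cheb_const k dx + cheb_const l dy + cheb_const l dy * cheb_const k dx <=
  8 / pi ^+ 2 *
     (4 / (k%:R * l%:R * (dx - k + 1)%:R ^+ k * (dy - l + 1)%:R ^+ l)
      + 2 * (dy + 1)%:R / (k%:R * (dx - k + 1)%:R ^+ k)
      + 2 * (dx + 1)%:R / (l%:R * (dy - l + 1)%:R ^+ l)) :> R.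
Proof.
move=> k0 l0 kd ld; have p0 := pi_gt0 R; have p1 := @pi_le R.
rewrite /cheb_const.
have ge1 j d : (0 < j)%N -> 1 <= j%:R * (d - j + 1)%:R ^+ j :> R.
  move=> j0; rewrite -natrX -natrM ler1n muln_gt0 j0 expn_gt0.
  by rewrite addn1.
have := ge1 k dx k0; have := ge1 l dy l0.
rewrite [k%:R * l%:R * _]mulrAC -[k%:R * _ * _ * _]mulrA.
move: (k%:R * _) (l%:R * _) => X Y Y1 X1.
have X0 : 0 < X by lra.
have Y0 : 0 < Y by lra.
have dx2 : 2 <= (dx + 1)%:R :> R by rewrite ler_nat addn1 ltnS (leq_trans k0).
have dy2 : 2 <= (dy + 1)%:R :> R by rewrite ler_nat addn1 ltnS (leq_trans l0).
(* [2 (d + 1)] is at least 4 because [d] is at least 1; this leaves a symmetric inequality in [X]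
   and [Y], both at least 1. *)
apply: (@le_trans _ _ (8 / pi ^+ 2 * (4 / (X * Y) + 4 / X + 4 / Y))); last first.
  rewrite ler_wpM2l ?divr_ge0 ?sqr_ge0// lerD// ?lerD//.
    by rewrite ler_wpM2r ?invr_ge0 ?(ltW X0)//; lra.
  by rewrite ler_wpM2r ?invr_ge0 ?(ltW Y0)//; lra.
move: pi p0 p1 => q q0 q1; rewrite -subr_ge0.
have -> : 8 / q ^+ 2 * (4 / (X * Y) + 4 / X + 4 / Y) -
    (41 / (6 * q) / X + 41 / (6 * q) / Y + 41 / (6 * q) / Y * (41 / (6 * q) / X)) =
    ((32 - 41 / 6 * q) * (X + Y) - (1681 / 36 - 32)) / (q ^+ 2 * X * Y).
  by field; rewrite !gt_eqF.
have den : 0 < q ^+ 2 * X * Y by rewrite !mulr_gt0// exprn_gt0.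
apply: divr_ge0 (ltW den).
(* [37 / 5] is [32 - 41 / 6 * (18 / 5)]. The worst case is [X = Y = 1], where [74 / 5 = 14.8] must
   exceed [1681 / 36 - 32], about [14.69]: this fixes the accuracy required of [pi_le]. *)
have c7 : 37 / 5 <= 32 - 41 / 6 * q by lra.
have s2 : 2 <= X + Y by lra.
have := ler_pM (_ : 0 <= 37 / 5) (_ : 0 <= 2) c7 s2.
by move: (_ * (X + Y)) => z; lra.
Qed.

Lemma le_combine_max (a b c : \bar R) (x y K B : R) :
  (0 <= a)%E -> (a < +oo)%E -> (b < +oo)%E -> (c < +oo)%E ->
  0 <= x -> 0 <= y -> x + y + y * x <= K * B ->
  (x%:E * b + y%:E * c + y%:E * (x%:E * a) <= K%:E * maxe a (maxe b c) * B%:E)%E.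
Proof.
move=> a0 aoo boo coo x0 y0 H; set V := maxe _ _.
have aV : (a <= V)%E by rewrite /V le_max lexx.
have bV : (b <= V)%E by rewrite /V !le_max lexx !orbT.
have cV : (c <= V)%E by rewrite /V !le_max lexx !orbT.
have Vfin : V \is a fin_num.
  by rewrite ge0_fin_numE ?(le_trans a0)// /V !gt_max aoo boo.
apply: (@le_trans _ _ (x%:E * V + y%:E * V + y%:E * (x%:E * V))%E).
  by rewrite !leeD// !lee_wpmul2l ?lee_fin.
have V0 : 0 <= fine V by rewrite fine_ge0// (le_trans a0).
rewrite -(fineK Vfin) -!EFinM -!EFinD lee_fin mulrAC.
apply: le_trans (ler_wpM2r V0 H).
by rewrite le_eqVlt; apply/orP; left; apply/eqP; ring.
Qed.

End BivariateError.

Theorem corollary3p2 (R : realType) (Omega : set (R * R)) (f : R * R -> R)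
    (k l : nat) (Omega_open : open Omega) (square_sub : square `<=` Omega)
    (k_ge1 : (1 <= k)%N) (l_ge1 : (1 <= l)%N)
    (c_exist : forall i j : nat, cheb_coef_exists f i j)
    (fxkyl_exists : forall p, square p -> partial_exists k l f p)
    (fxkyl_bv : vitali_bounded_variation (partial k l f))
    (ckl_exist : forall i j : nat,
      stieltjes_cheb_coef_exists (partial k l f) i j)
    (Vkl_fin : (Vxy k l f < +oo)%E)
    (fxk_exists : forall p, square p -> partial_exists k 0 f p)
    (fxk_bv : forall y0 : R, y0 \in `[-1, 1] ->
      bounded_variation (-1) 1 (fun x => partial k 0 f (x, y0)))
    (Vk_fin : (Vx k f < +oo)%E)
    (fyl_exists : forall p, square p -> partial_exists 0 l f p)
    (fyl_bv : forall x0 : R, x0 \in `[-1, 1] ->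
      bounded_variation (-1) 1 (fun y => partial 0 l f (x0, y)))
    (Vl_fin : (Vy l f < +oo)%E) :
  forall dx dy nx ny : nat,
    (k <= nx - 1)%N -> (l <= ny - 1)%N ->
    (k <= dx < nx)%N -> (l <= dy < ny)%N ->
    (L1norm (fun p => f p - cheb_approx nx ny dx dy f p)%R <=
     (8 / pi ^+ 2)%:E * maxe (Vxy k l f) (maxe (Vx k f) (Vy l f)) *
     (4 / (k%:R * l%:R * (dx - k + 1)%:R ^+ k * (dy - l + 1)%:R ^+ l)
      + 2 * (dy + 1)%:R / (k%:R * (dx - k + 1)%:R ^+ k)
      + 2 * (dx + 1)%:R / (l%:R * (dy - l + 1)%:R ^+ l))%:E)%E.
Proof.
move=> dx dy nx ny _ _ kdn ldn.
have mf := cheb_coef_exists_measurable (c_exist 0%N 0%N).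
have sq (x y : R) : -1 <= x <= 1 -> -1 <= y <= 1 -> square (x, y).
  by move=> x1 y1; split; rewrite /= in_itv.
have bx (y : R) : -1 <= y <= 1 -> bounded_variation (-1) 1 (fun x => partial k 0 f (x, y)).
  by move=> y1; apply: fxk_bv; rewrite in_itv.
have by_ (x : R) : -1 <= x <= 1 -> bounded_variation (-1) 1 (fun y => partial 0 l f (x, y)).
  by move=> x1; apply: fyl_bv; rewrite in_itv.
have sx (y : R) : -1 <= y <= 1 -> smooth11 k (fun x => f (x, y)).
  move=> y1.
  apply: (@smooth11_bounded_variation _ k (fun x => f (x, y)) k_ge1 _ (bx y y1)) => x x1.
  by have [_ _] := fxk_exists _ (sq x y x1 y1).
have sy (x : R) : -1 <= x <= 1 -> smooth11 l (fun y => f (x, y)).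
  move=> x1.
  apply: (@smooth11_bounded_variation _ l (fun y => f (x, y)) l_ge1 _ (by_ x x1)) => y y1.
  by have [] := fyl_exists _ (sq x y x1 y1).
have [hf _] := ckl_exist 0%N 0%N.
have Bx := x_remainder_le k_ge1 kdn mf sx bx.
have By := y_remainder_le l_ge1 ldn mf sy by_.
have Bxy := mixed_remainder_le k_ge1 l_ge1 kdn ldn mf sy fxkyl_exists fxkyl_bv hf.
have mr := measurable_on_squareB mf (measurable_on_square_projx nx dx mf).
apply: le_trans (L1norm_triangle _ _ _ _) _.
- exact: mr.
- exact: measurable_on_squareB mf (measurable_on_square_projy ny dy mf).
- exact: measurable_on_squareB mr (measurable_on_square_projy ny dy mr).
- move=> p /=; rewrite cheb_approxE cheb_projB; case: p => x y /=; ring.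
apply: le_trans (leeD (leeD Bx By) Bxy) _.
have kd : (k <= dx)%N by case/andP: kdn.
have ld : (l <= dy)%N by case/andP: ldn.
apply: le_combine_max Vkl_fin Vk_fin Vl_fin _ _ (cheb_const_sum_le k_ge1 l_ge1 kd ld).
- by apply: integral_ge0 => p _; rewrite lee_fin mulr_ge0 ?weight1_ge0.
- exact: ltW (cheb_const_gt0 dx k_ge1).
- exact: ltW (cheb_const_gt0 dy l_ge1).
Qed.
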